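(* Let $B\subseteq\mathbb{R}^d$ be a generic convex polytope with non-empty interior. Then there exist a constant $c_{d,B}>0$ depending only on $d$ and $B$ and an integer $n_0$ such that $\operatorname{disc}(n,\mathcal{T}_B) \ge c_{d,B}\log^{d-1} n$ for all $n\ge n_0$; that is, $\operatorname{disc}(n,\mathcal{T}_B) = \Omega_{d,B}(\log^{d-1} n)$.
   Context: For a finite set $P$ and a family $\mathcal{F}$ of subsets of $P$, $\operatorname{disc}\mathcal{F} := \min_{\chi\colon P\to\{-1,1\}} \max_{F\in\mathcal{F}} \left|\sum_{p\in F}\chi(p)\right|$. For a family $\mathcal{F}$ of subsets of $\mathbb{R}^d$ and a finite $P\subset\mathbb{R}^d$, $\mathcal{F}(P) := \{F\cap P : F\in\mathcal{F}\}$, and $\operatorname{disc}(n,\mathcal{F}) := \sup\{\operatorname{disc}\mathcal{F}(P) : P\subset\mathbb{R}^d,\ |P| = n\}$. For $K\subseteq\mathbb{R}^d$, $\mathcal{T}_K := \{tK + x : t>0,\ x\in\mathbb{R}^d\}$. A polytope $B$ in $\mathbb{R}^d$ is called generic if there exists a chain of faces $F_1\subseteq F_2\subseteq\cdots\subseteq F_{d-1}$ of $B$ such that each $F_j$ is a face of dimension $j$, for every $j\le d-2$ the face $F_j$ is not parallel to any other face of $F_{j+1}$, and the facet $F_{d-1}$ is not parallel to any other facet of $B$. *)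

(* Defs.v *)
From HB Require Import structures.
From mathcomp Require Import all_boot all_order all_algebra finmap.
From mathcomp Require Import all_classical all_reals all_analysis.

Set Implicit Arguments.
Unset Strict Implicit.
Unset Printing Implicit Defensive.

Import Order.TTheory GRing.Theory Num.Theory.
Import numFieldNormedType.Exports.

Local Open Scope classical_set_scope.
Local Open Scope ring_scope.

Section Discrepancy.
Variable T : finType.

(* [chi : {ffun T -> bool}] encodes the colouring p |-> (-1) ^+ chi p. *)
Definition coloring_disc (G : {set {set T}}) (chi : {ffun T -> bool}) : nat :=
  (\max_(A in G) `|(\sum_(p in A) (-1) ^+ chi p : int)%R|)%N.

Definition disc (G : {set {set T}}) : nat :=
  coloring_disc G
    [arg min_(chi < [ffun=> true] : {ffun T -> bool}) coloring_disc G chi]%N.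

End Discrepancy.

Section RangeSpaces.
Variables (R : realType) (d : nat).
Implicit Types (P : {fset 'rV[R]_d}) (Fam : set (set 'rV[R]_d)).

(* The family { F `&` P : F in Fam }, as sets over the finite type [P]. *)
Definition trace_family Fam P : {set {set P}} :=
  [set A : {set P} |
    `[< exists2 F, Fam F & forall p : P, p \in A <-> F (val p) >]]%SET.

(* Extended-real supremum: bounded by n, and -oo if no n-point set exists
   (which requires d = 0). *)
Definition disc_n (n : nat) Fam : \bar R :=
  ereal_sup [set (disc (trace_family Fam P))%:R%:E | P in [set P | #|` P| = n]].

Definition homothets (K : set 'rV[R]_d) : set (set 'rV[R]_d) :=
  [set F | exists t x, 0 < t /\ F = [set t *: y + x | y in K]].

End RangeSpaces.

Section Polytopes.
Variables (R : realType) (d : nat).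
Implicit Types (S K B F G : set 'rV[R]_d).

Definition convex_hull S : set 'rV[R]_d :=
  [set x | exists (n : nat) (a : 'I_n -> R) (p : 'I_n -> 'rV[R]_d),
    [/\ forall i, S (p i), forall i, 0 <= a i,
        \sum_i a i = 1 & x = \sum_i a i *: p i]].

Definition affine_hull S : set 'rV[R]_d :=
  [set x | exists (n : nat) (a : 'I_n -> R) (p : 'I_n -> 'rV[R]_d),
    [/\ forall i, S (p i), \sum_i a i = 1 & x = \sum_i a i *: p i]].

Definition polytope B := exists2 V, finite_set V & B = convex_hull V.

Definition has_dim S (k : nat) :=
  exists (x : 'rV[R]_d) (U : {vspace 'rV[R]_d}),
    \dim U = k /\ affine_hull S = [set x + u | u in [set` U]].

(* Sets of different dimensions are never parallel; in particular a face is
   not parallel to the lower-dimensional faces or to the polytope itself. *)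
Definition parallel S K :=
  exists v : 'rV[R]_d, affine_hull K = [set x + v | x in affine_hull S].

(* [a = 0] gives the improper faces [B] and [set0]. *)
Definition face B F :=
  exists (a : 'rV[R]_d) (c : R),
    (forall x, B x -> \sum_i a 0 i * x 0 i <= c) /\
    F = [set x | B x /\ \sum_i a 0 i * x 0 i = c].

Definition facet B F := face B F /\ has_dim F d.-1.

(* Only the values F j with 1 <= j <= d - 1 are constrained. *)
Definition generic B :=
  exists F : nat -> set 'rV[R]_d,
    [/\ forall j, (1 <= j <= d.-1)%N -> face B (F j) /\ has_dim (F j) j,
        forall j, (1 <= j <= d.-2)%N -> F j `<=` F j.+1,
        forall j, (1 <= j <= d.-2)%N ->
          forall G, face (F j.+1) G -> G <> F j -> ~ parallel (F j) G
      & (1 <= d.-1)%N ->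
          forall G, facet B G -> G <> F d.-1 -> ~ parallel (F d.-1) G].

End Polytopes.

(* Main.v *)
(** By the determinant bound of Lovasz, Spencer and Vesztergombi it suffices to find many
    homothets and points whose incidence matrix has a large determinant.

    Fix a flag of faces of [B] and flag coordinates [x_1, ..., x_d] at its vertex. On points
    [(eps y_1, eps^2 y_2, ..., eps^d y_d)] with [y] in a finite grid and [eps] small, a large
    homothet of [B] cuts out exactly an orthant [{y | w <= y}]: only the functionals supporting
    the faces of the flag matter, and they are triangular in these coordinates.

    For orthants in a grid of side [m], the incidence matrix is a tensor power of the [m * m]
    triangular matrix of ones. Test it against tensor Haar functions [W] on the right and
    tensors [U] of (+, -, -, +) patterns on the left, both indexed by the dyadic boxes of
    a fixed volume [2^-s]: summation turns a Haar function into a tent, which the pattern on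
    a strictly smaller interval annihilates, and boxes of equal volume are never strictly
    nested, so [U A W] is diagonal. There are [k], at least [2^s (c log m)^(d-1)], such boxes,
    and the Cauchy-Binet formula yields a [k * k] minor of [A] whose [k]-th root has order
    [k / 2^s]. *)
Require Import Defs.
From mathcomp Require Import all_boot all_order all_fingroup all_algebra finmap.
From mathcomp Require Import all_classical all_reals all_analysis.
From mathcomp Require Import zify ring lra.
Import Order.TTheory GRing.Theory Num.Theory.
Import numFieldNormedType.Exports.
Local Open Scope ring_scope.

Set Implicit Arguments.
Unset Strict Implicit.
Unset Printing Implicit Defensive.

(** * The determinant bound for hereditary discrepancy *)

Lemma expnD_le (a e k : nat) :
  ((a + e) ^ k <= a ^ k + e * k * (a + e) ^ k.-1)%N.
Proof.
elim: k => [|k IHk]; first by rewrite !expn0.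
have h : ((a + e) * (e * k * (a + e) ^ k.-1) = e * k * (a + e) ^ k)%N.
  by case: k {IHk} => [|k]; [rewrite muln0 !mul0n muln0 | rewrite expnS; ring].
have h2 : (a ^ k <= (a + e) ^ k)%N.
  by case: k {IHk h} => // k; rewrite leq_exp2r ?leq_addr.
have := leq_mul (leqnn (a + e)) IHk.
rewrite mulnDr h -expnS /= mulnDl -expnS => /leq_trans; apply.
have := leq_mul (leqnn e) h2; nia.
Qed.

(** After division by [(2 ^ s) ^ k] the error [e] becomes negligible for large [s]; as [c] and
    [x ^ k] are integers, one explicit [s] suffices. *)
Lemma expn_asymptotic_bound (c x e k : nat) :
  (forall s, c * (2 ^ s) ^ k <= (x * 2 ^ s + e) ^ k)%N -> (c <= x ^ k)%N.
Proof.
move=> H; rewrite leqNgt; apply/negP => lt_xc.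
case: k => [|k] in H lt_xc *; first by have := H 0%N; rewrite !expn0; lia.
(* The error term of [expnD_le] is at most [K * q ^ k], which is below [q ^ k.+1] because
   [K < 2 ^ K = q]. *)
pose K := (e * k.+1 * (x + e) ^ k)%N; pose q := (2 ^ K)%N.
have qK : (K < q)%N by apply: ltn_expl.
have q0 : (0 < q)%N by rewrite expn_gt0.
have := leq_trans (H K) (expnD_le _ _ _).
rewrite -/q expnMn /=; apply/negP; rewrite -ltnNge.
have h3 : ((x * q + e) ^ k <= (x + e) ^ k * q ^ k)%N.
  rewrite -expnMn; case: (k) => // k'.
  by rewrite leq_exp2r // mulnDl leq_add2l leq_pmulr.
apply: (@leq_trans ((x ^ k.+1).+1 * q ^ k.+1)%N); last by rewrite leq_mul2r lt_xc orbT.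
rewrite mulSn addnC ltn_add2r.
apply: (@leq_ltn_trans (K * q ^ k)%N).
  by rewrite /K -!mulnA; do 2!apply: leq_mul => //.
by rewrite expnS ltn_pmul2r // expn_gt0 q0.
Qed.

Lemma unitmx_int_det (k : nat) (L : 'M[int]_k) : L \in unitmx -> `|\det L|%N = 1%N.
Proof. by rewrite unitmxE; case/orP => /eqP ->. Qed.

Lemma small_multiple_eq (x y q : nat) (z : int) : (x < q)%N -> (y < q)%N ->
  `|x%:Z - y%:Z|%N = (q * `|z|)%N -> x = y.
Proof.
move=> lt_x lt_y; have [->|] := eqVneq z 0; first by rewrite muln0; lia.
rewrite -absz_gt0 => z0; have := leq_pmulr q z0; lia.
Qed.

(** By the Smith normal form [M = L Dg Q] with [L], [Q] unimodular, the lattice [M Z^k] is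
    [L Dg Z^k]. The images under [L] of the integer points of the box with sides [|dd_i|] are
    pairwise incongruent modulo it, and there are [|det M|] of them. *)
Lemma coset_representatives (k : nat) (M : 'M[int]_k) :
  exists r : 'I_`|\det M|%N -> 'cV[int]_k,
    forall s t b, r s - r t = M *m b -> s = t.
Proof.
have [L uL [Q uQ [dd _ ->]]] := int_Smith_normal_form M.
set Dg := (X in L *m X *m Q).
have detDg : \det Dg = \prod_(i < k) dd`_i.
  rewrite det_trig; first by apply: eq_bigr => i _; rewrite mxE eqxx.
  by apply/is_trig_mxP => i j ij; rewrite mxE (ltn_eqF ij).
pose del i := absz (dd`_i).
have -> : `|\det (L *m Dg *m Q)|%N = (\prod_(i < k) del i)%N.
  rewrite !det_mulmx !abszM (unitmx_int_det uL) (unitmx_int_det uQ) mul1n muln1 detDg.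
  by elim/big_rec2: _ => // i x y _ <-; rewrite abszM.
(* [N] bounds all the sides at once, so the box becomes a family inside a single finite function
   type. *)
pose N := (\sum_(i < k) del i)%N.
pose Fam := family (fun i : 'I_k => [pred x : 'I_N.+1 | (x < del i)%N]).
have cardFam : #|Fam| = (\prod_(i < k) del i)%N.
  rewrite card_family foldrE big_map big_enum /=; apply: eq_bigr => i _.
  have le_iN : (del i <= N.+1)%N.
    by rewrite /N (bigD1 i) //= -addSn addnC -addSnnS leq_addl.
  have inj : injective (widen_ord le_iN) by move=> y z /(congr1 val) /= /val_inj.
  rewrite -[RHS]card_ord -(card_codom (inj)); apply: eq_card => x.
  rewrite [x \in _]unfold_in /=; apply/idP/codomP => [lt_x|[y ->]]; last exact: (ltn_ord y).
  by exists (Ordinal lt_x); apply: val_inj.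
rewrite -cardFam.
exists (fun s => L *m \col_i (((enum_val s : {ffun 'I_k -> 'I_N.+1}) i : nat)%:Z)) => s t b.
rewrite -mulmxBr -!mulmxA => /(can_inj (mulKmx uL)) eq_st.
apply: enum_val_inj; apply/ffunP => i; apply: val_inj.
have /familyP/(_ i) := enum_valP s; have /familyP/(_ i) := enum_valP t.
move: eq_st; move: (enum_val s) (enum_val t) => x y /matrixP/(_ i 0).
rewrite !mxE (bigD1 i) //= big1 => [|j ji]; last first.
  by rewrite mxE (negbTE (_ : (i : nat) != j)) ?mulr0n ?mul0r // eq_sym.
rewrite mxE eqxx mulr1n addr0 !unfold_in /=.
set z := (Q *m b) i 0 => eqz lt_y lt_x.
by apply: (small_multiple_eq lt_x lt_y (z := z)); rewrite eqz abszM.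
Qed.

(* Only the parity of [chi] is prescribed: a colouring of [J] extended by zero qualifies. *)
Definition hereditary_disc_le (k : nat) (M : 'M[int]_k) (D : nat) :=
  forall J : {set 'I_k}, exists chi : 'cV[int]_k,
    (forall i, exists c, (i \in J : nat)%:Z = chi i 0 + 2 * c) /\
    forall i, (`|(M *m chi) i 0%R| <= D)%N.

(** Subtract a colouring with the parity of [a], halve, and repeat. The errors add up to [D * (1 + 2
    + ... + 2 ^ (s - 1)) = D * (2 ^ s - 1)]. *)
Lemma dyadic_residues (k : nat) (M : 'M[int]_k) (D : nat) :
  hereditary_disc_le M D -> forall s (a : 'cV[int]_k),
  exists b c : 'cV[int]_k, a = b + (2 ^+ s) *: c /\
    forall i, (`|(M *m b) i 0%R| + D <= D * 2 ^ s)%N.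
Proof.
move=> herM; elim=> [|s IHs] a.
  by exists 0, a; rewrite expr0 scale1r add0r; split=> // i; rewrite mulmx0 mxE expn0 muln1.
have [chi [chiP leD]] := herM [set i | odd `|a i 0%R|].
have /fin_all_exists[c cP] i : exists c, a i 0 = chi i 0 + 2 * c.
  have [c] := chiP i; rewrite inE => hc.
  have := divn_eq `|a i 0%R| 2; rewrite modn2; move: hc.
  by case: odd => /= hc ha; exists (divz (a i 0) 2 + c); lia.
have [b [e [eqc leb]]] := IHs (\col_i c i).
exists (chi + 2 *: b), e; split.
  apply/matrixP => i j; rewrite ord1 !mxE cP exprS.
  have /matrixP/(_ i 0) := eqc; rewrite !mxE => ->; ring.
move=> i; rewrite mulmxDr -scalemxAr mxE [X in _ + X]mxE expnS; have := leD i; have := leb i.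
have : (0 < 2 ^ s)%N by rewrite expn_gt0.
move: ((M *m chi) i 0) ((M *m b) i 0) => x y; nia.
Qed.

(* Lovasz, Spencer and Vesztergombi. By [dyadic_residues], for every [s] each class modulo [2 ^ s]
   has a representative [b] with [M b] in the cube of radius [D * 2 ^ s]; but the lattice
   [M Z^k] has index [|det M|], so about a [1 / |det M|] fraction of the integer points of
   that cube are of the form [M b]. *)
Lemma det_le_hereditary_disc (k : nat) (M : 'M[int]_k) (D : nat) :
  hereditary_disc_le M D -> (`|\det M| <= (2 * D) ^ k)%N.
Proof.
move=> herM; have [->//|det_n0] := eqVneq (\det M) 0.
have [r rP] := coset_representatives M.
pose C := (\sum_s \sum_i `|r s i 0%R|)%N.
have leC s i : (`|r s i 0%R| <= C)%N.
  by rewrite /C (bigD1 s) //= (bigD1 i) //= -addnA leq_addr.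
(* A cube of radius [D q + C] with [q = 2 ^ s] has [2 D q + (2 C + 1)] integers along each side. *)
apply: (@expn_asymptotic_bound _ _ (C.*2).+1) => s.
pose q := (2 ^ s)%N; pose X := (D * q + C)%N.
have /fin_all_exists[b bP] (a : {ffun 'I_k -> 'I_q}) : exists b : 'cV[int]_k,
    (exists c, \col_i ((a i : nat)%:Z) = b + (2 ^+ s) *: c) /\
    forall i, (`|(M *m b) i 0%R| + D <= D * 2 ^ s)%N.
  by have [b [c [? ?]]] := dyadic_residues herM s (\col_i ((a i : nat)%:Z));
     exists b; split=> //; exists c.
have M_inj (x : 'cV[int]_k) : M *m x = 0 -> x = 0.
  move=> /(congr1 (mulmx (\adj M))); rewrite mulmx0 mulmxA mul_adj_mx mul_scalar_mx.
  move=> /matrixP eq0; apply/matrixP => i j; have := eq0 i j; rewrite !mxE => /eqP.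
  by rewrite mulf_eq0 (negPf det_n0) => /eqP.
(* The coset of [v p] modulo [M Z^k] recovers [p.2]; injectivity of [M] then recovers [b p.1], whose
   class modulo [q] is [p.1]. *)
pose v (p : {ffun 'I_k -> 'I_q} * 'I_`|\det M|%N) := M *m b p.1 + r p.2.
have v_le p i : (`|v p i 0%R| <= X)%N.
  rewrite /v mxE; have [_ /(_ i)] := bP p.1; have := leC p.2 i => h1 h2.
  by rewrite /X /q; move: h2; move: ((M *m b p.1) i 0) (r p.2 i 0) h1 => x y; lia.
pose f p : {ffun 'I_k -> 'I_(X.*2).+1} := [ffun i => inord `|(v p i 0 + X%:Z)%R|%N].
have f_inj : injective f.
  move=> p1 p2 /ffunP eqf.
  have eqv : v p1 = v p2.
    apply/matrixP => i j; rewrite ord1; have := congr1 val (eqf i).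
    rewrite !ffunE; have := v_le p1 i; have := v_le p2 i; move: (v p1 i 0) (v p2 i 0) => x y hx hy.
    by rewrite /= !inordK; lia.
  move: p1 p2 eqv {eqf} => [a s1] [a' s2]; rewrite /v /= => eqv.
  have eqs : s1 = s2.
    by apply: (rP _ _ (b a' - b a)); rewrite mulmxBr; apply/eqP;
       rewrite subr_eq addrAC eq_sym subr_eq -eqv addrC.
  rewrite {}eqs in eqv *; congr (_, _).
  move/addIr: eqv => /eqP; rewrite -subr_eq0 -mulmxBr => /eqP /M_inj eqb.
  have [[c cP] _] := bP a; have [[c' cP'] _] := bP a'.
  apply/ffunP => i; apply: val_inj => /=.
  move: cP cP' eqb => /matrixP/(_ i 0) + /matrixP/(_ i 0) + /matrixP/(_ i 0).
  rewrite !mxE => h1 h2 h3.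
  have lt1 : (a i < q)%N by []. have lt2 : (a' i < q)%N by [].
  have hq : 2 ^+ s = q%:Z :> int by rewrite /q -natrX natz.
  have : (a i : nat)%:Z - (a' i : nat)%:Z = q%:Z * (c i 0 - c' i 0).
    by rewrite h1 h2 hq; move: h3 => /eqP; rewrite subr_eq0 => /eqP ->; ring.
  move: (c i 0 - c' i 0) => z.
  by move=> eqz; apply: (small_multiple_eq lt1 lt2 (z := z)); rewrite eqz abszM.
have := leq_card f f_inj.
rewrite card_prod !card_ffun !card_ord mulnC => /leq_trans; apply.
by case: (k) => // k'; rewrite leq_exp2r // /X -muln2 mulnDl addnS; lia.
Qed.

(** * Sums of minors *)

(** Multilinearity in the rows gives a sum over all functions [f] instead of [k]-subsets; a
    non-injective [f] contributes a zero minor. *)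
Lemma Cauchy_Binet_ffun (R : comNzRingType) (T : finType) (k : nat)
    (X : 'I_k -> T -> R) (Y : T -> 'I_k -> R) :
  \det (\matrix_(i, j) \sum_t X i t * Y t j) =
  \sum_(f : {ffun 'I_k -> T})
    (\prod_i X i (f i)) * \det (\matrix_(i, j) Y (f i) j).
Proof.
transitivity (\sum_(s : 'S_k) \sum_(f : {ffun 'I_k -> T})
    (-1) ^+ s * \prod_i (X i (f i) * Y (f i) (s i))).
  apply: eq_bigr => s _; rewrite -big_distrr /=; congr (_ * _).
  rewrite -(bigA_distr_bigA (fun i t => X i t * Y t (s i))) /=.
  by apply: eq_bigr => i _; rewrite mxE.
rewrite exchange_big; apply: eq_bigr => f _ /=.
rewrite big_distrr /=; apply: eq_bigr => s _.
rewrite big_split /= mulrCA; congr (_ * (_ * _)).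
by apply: eq_bigr => i _; rewrite mxE.
Qed.

(** Summing over the reindexings of [f] by permutations turns the product of the [X i (f i)] into a
    determinant, at the price of [k!]. *)
Lemma Cauchy_Binet_ffun_sym (R : comNzRingType) (T : finType) (k : nat)
    (X : 'I_k -> T -> R) (Y : T -> 'I_k -> R) :
  k`!%:R * \det (\matrix_(i, j) \sum_t X i t * Y t j) =
  \sum_(f : {ffun 'I_k -> T})
    \det (\matrix_(i, j) X i (f j)) * \det (\matrix_(i, j) Y (f i) j).
Proof.
transitivity (\sum_(s : 'S_k) \sum_(f : {ffun 'I_k -> T})
    (-1) ^+ s * \prod_i X i (f (s i)) * \det (\matrix_(i, j) Y (f i) j)).
  rewrite -card_Sn -sum1_card natr_sum mulr_suml.
  apply: eq_big => [s|s _]; first by rewrite inE.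
  rewrite mul1r Cauchy_Binet_ffun.
  pose h (u : 'S_k) (f : {ffun 'I_k -> T}) := [ffun i => f (u i)].
  have hK u : cancel (h u) (h u^-1%g).
    by move=> f; apply/ffunP => i; rewrite !ffunE permKV.
  rewrite (reindex_inj (can_inj (hK s))) /=; apply: eq_bigr => f _.
  have -> : \matrix_(i, j) Y (h s f i) j = row_perm s (\matrix_(i, j) Y (f i) j).
    by apply/matrixP => i j; rewrite !mxE ffunE.
  rewrite row_permE det_mulmx det_perm mulrA [_ * (-1) ^+ _]mulrC.
  by congr (_ * _ * _); apply: eq_bigr => i _; rewrite ffunE.
rewrite exchange_big; apply: eq_bigr => f _ /=; rewrite -mulr_suml.
congr (_ * _); apply: eq_bigr => s _; congr (_ * _).
by apply: eq_bigr => i _; rewrite mxE.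
Qed.

Section DetBound.
Variables (T : finType) (k r : nat).
Implicit Types U : 'I_k -> T -> int.

Definition orthogonal_rows U :=
  forall i j, \sum_t U i t * U j t = r%:R *+ (i == j).

(** Cauchy-Binet for [U U^T], which is [r] times the identity. *)
Lemma sum_sqr_minors U : orthogonal_rows U ->
  \sum_(f : {ffun 'I_k -> T}) (\det (\matrix_(i, j) U i (f j))) ^+ 2 =
  k`!%:R * r%:R ^+ k.
Proof.
move=> orthU; rewrite -(det_scalar k r%:R).
have -> : r%:R%:M = \matrix_(i, j) \sum_t U i t * U j t :> 'M[int]_k.
  by apply/matrixP => i j; rewrite !mxE orthU.
rewrite Cauchy_Binet_ffun_sym; apply: eq_bigr => f _; rewrite expr2.
by rewrite -[X in _ * \det X]trmxK det_tr; congr (_ * \det _); apply/matrixP => i j; rewrite !mxE.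
Qed.

(** Cauchy-Schwarz against the constant one, read off from the sum of all [(|F i| - |F j|) ^ 2]. *)
Lemma sqr_sum_le (I : finType) (F : I -> int) :
  (\sum_i `|F i|) ^+ 2 <= #|I|%:R * \sum_i F i ^+ 2.
Proof.
have : 0 <= \sum_i \sum_j (`|F i| - `|F j|) ^+ 2.
  by do 2!apply: sumr_ge0 => ? _; exact: sqr_ge0.
have -> : \sum_i \sum_j (`|F i| - `|F j|) ^+ 2 =
    2 * (#|I|%:R * \sum_i F i ^+ 2 - (\sum_i `|F i|) ^+ 2).
  transitivity (\sum_i \sum_j (F i ^+ 2 - `|F i| * `|F j| *+ 2 + F j ^+ 2)).
    by do 2!apply: eq_bigr => ? _; rewrite sqrrB !real_normK ?num_real.
  under eq_bigr do rewrite big_split sumrB /= sumr_const sumrMnl -mulr_sumr.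
  rewrite big_split sumrB /= sumr_const !sumrMnl -mulr_suml.
  rewrite -mulr_natl -[_ *+ #|_|]mulr_natl; ring.
by rewrite pmulr_rge0 // subr_ge0.
Qed.

Lemma sum_minors_le U : orthogonal_rows U ->
  (\sum_(f : {ffun 'I_k -> T}) `|\det (\matrix_(i, j) U i (f j))|) ^+ 2 <=
  (#|T| ^ k * k`! * r ^ k)%N%:R.
Proof.
move=> /sum_sqr_minors eqU; apply: le_trans (sqr_sum_le _) _.
by rewrite eqU card_ffun card_ord !natrM !natrX mulrA.
Qed.

(** Two applications of Cauchy-Binet write [k!^2] times the determinant as a sum of products of
    minors of [U], [A] and [W]. Those of [A] are at most [Delta], those of [U] and [W] are summed by
    [sum_minors_le], and one [k!] cancels. *)
Lemma det_sandwich_le (A : T -> T -> int) (U W : 'I_k -> T -> int) (Delta : nat) :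
  orthogonal_rows U -> orthogonal_rows W ->
  (forall f g : 'I_k -> T, (`|\det (\matrix_(i, j) A (f i) (g j))%R| <= Delta)%N) ->
  (k`! * `|\det (\matrix_(i, j) \sum_t \sum_u U i t * (A t u * W j u))%R| <=
   Delta * #|T| ^ k * r ^ k)%N.
Proof.
move=> oU oW leA.
set D := \det _.
have eqD : (k`! ^ 2)%N%:R * D = \sum_(f : {ffun 'I_k -> T}) \sum_(g : {ffun 'I_k -> T})
    \det (\matrix_(i, j) U i (f j)) * (\det (\matrix_(i, j) A (f i) (g j)) *
      \det (\matrix_(i, j) W i (g j))).
  have -> : D = \det (\matrix_(i, j) \sum_t U i t * \sum_u (A t u * W j u)).
    by congr (\det _); apply/matrixP => i j; rewrite !mxE; apply: eq_bigr => t _; rewrite mulr_sumr.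
  rewrite expnS expn1 natrM -mulrA (Cauchy_Binet_ffun_sym U) mulr_sumr.
  apply: eq_bigr => f _; rewrite mulrCA.
  rewrite (Cauchy_Binet_ffun_sym (fun i u => A (f i) u) (fun u j => W j u)) mulr_sumr.
  apply: eq_bigr => g _; congr (_ * (_ * _)).
  by rewrite -det_tr; congr (\det _); apply/matrixP => i j; rewrite !mxE.
pose S (V : 'I_k -> T -> int) := \sum_(f : {ffun 'I_k -> T}) `|\det (\matrix_(i, j) V i (f j))|.
have S_ge0 V : 0 <= S V by apply: sumr_ge0.
have : (k`! ^ 2)%N%:R * `|D| <= Delta%:R * (S U * S W).
  rewrite -[(k`! ^ 2)%N%:R]ger0_norm ?ler0n // -normrM eqD.
  rewrite /S mulr_suml mulr_sumr; apply: le_trans (ler_norm_sum _ _ _) _.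
  apply: ler_sum => f _; rewrite !mulr_sumr; apply: le_trans (ler_norm_sum _ _ _) _.
  apply: ler_sum => g _; rewrite !normrM mulrCA; apply: ler_wpM2r => //.
  by rewrite natz -abszE lez_nat; apply: leA.
move=> leD.
have leS : S U * S W <= (#|T| ^ k * k`! * r ^ k)%N%:R.
  rewrite -(@ler_sqr _ _ _) ?nnegrE ?ler0n ?mulr_ge0 // exprMn [X in _ <= X]expr2.
  by apply: ler_pM; rewrite ?sqr_ge0 // sum_minors_le.
have {leD leS} := le_trans leD (ler_wpM2l (ler0n _ Delta) leS).
rewrite -abszE -!natz -!natrM ler_nat.
have : (0 < k`!)%N by apply: fact_gt0.
nia.
Qed.
End DetBound.

(** * Haar functions on an interval *)

Definition haar (b q x : nat) : int := (b <= x < b + q)%N%:Z - (b + q <= x < b + 2 * q)%N%:Z.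

Lemma sum_indicator (m a q : nat) (F : nat -> int) : (a + q <= m)%N ->
  \sum_(x < m) (a <= x < a + q)%N%:Z * F x = \sum_(t < q) F (a + t)%N.
Proof.
elim: q => [|q IHq] le_m.
  by rewrite big_ord0 big1 // => x _; rewrite addn0 -ltnS; case: ltngtP; rewrite ?mul0r.
rewrite big_ord_recr /= -IHq; last by lia.
have lt_m : (a + q < m)%N by lia.
rewrite (bigD1 (Ordinal lt_m)) //= [in RHS](bigD1 (Ordinal lt_m)) //=.
rewrite ltnn andbF mul0r add0r addrC; congr (_ + _); last first.
  by rewrite leq_addr addnS ltnSn mul1r.
apply: eq_bigr => x /eqP nx; congr ((_ : bool)%:Z * _).
have : (x : nat) <> (a + q)%N by move=> e; apply: nx; apply: val_inj.
lia.
Qed.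

Lemma sum_haar (m b q : nat) (F : nat -> int) : (b + 2 * q <= m)%N ->
  \sum_(x < m) haar b q x * F x = \sum_(t < q) (F (b + t)%N - F (b + q + t)%N).
Proof.
move=> le_m; rewrite sumrB -!(@sum_indicator m) -?sumrB; try lia.
by apply: eq_bigr => x _; rewrite /haar mulrBl mul2n -addnn addnA.
Qed.

(** Values at points [q] apart differ by [s q], and there are [q] such pairs. *)
Lemma sum_haar_affine (m b q : nat) (c s : int) (F : nat -> int) :
  (b + 2 * q <= m)%N ->
  (forall t, (t < 2 * q)%N -> F (b + t)%N = c + s * t%:Z) ->
  \sum_(x < m) haar b q x * F x = - (s * q%:Z ^+ 2).
Proof.
move=> le_m affF; rewrite sum_haar //.
rewrite (eq_bigr (fun=> - (s * q%:Z))) => [|t _].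
  by rewrite sumr_const card_ord -mulr_natl natz; ring.
have lt_t := ltn_ord t.
rewrite affF -?addnA ?affF; try lia. 
Qed.

(** Because subtraction on [nat] truncates, this is an inverted tent: zero outside [[b, b + 2q]],
    falling with slope -1 to [-q] at [b + q], then rising with slope 1. *)
Definition tent (b q w : nat) : int := (q - (w - b))%N%:Z - (q - (w - (b + q)))%N%:Z.

Lemma sum_prefix_haar (m b q w : nat) : (b + 2 * q <= m)%N ->
  \sum_(y < m) (w <= y)%N%:Z * haar b q y = tent b q w.
Proof.
move=> le_m; under eq_bigr do rewrite mulrC.
rewrite (sum_haar (fun y => (w <= y)%N%:Z)) // sumrB /tent.
have cnt c : \sum_(t < q) (w <= c + t)%N%:Z = (q - (w - c))%N%:Z.
  elim: (q) => [|p IHp]; first by rewrite big_ord0.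
  by rewrite big_ord_recr /= IHp; case: leqP; lia.
by rewrite !cnt.
Qed.

(** The pattern (+, -, -, +) on four blocks of length [p]. Its moments of order 0 and 1 vanish, so
    it annihilates affine functions. *)
Definition quarters (b p x : nat) : int := haar b p x - haar (b + 2 * p) p x.

Lemma sum_quarters (m b p : nat) (F : nat -> int) :
  \sum_(x < m) quarters b p x * F x =
  \sum_(x < m) haar b p x * F x - \sum_(x < m) haar (b + 2 * p) p x * F x.
Proof. by rewrite -sumrB; apply: eq_bigr => x _; rewrite mulrBl. Qed.

Lemma sum_quarters_affine (m b p : nat) (c s : int) (F : nat -> int) :
  (b + 4 * p <= m)%N ->
  (forall t, (t < 4 * p)%N -> F (b + t)%N = c + s * t%:Z) ->
  \sum_(x < m) quarters b p x * F x = 0.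
Proof.
move=> le_m affF; rewrite sum_quarters.
rewrite (@sum_haar_affine _ _ _ c s); [|lia|by move=> t lt_t; apply: affF; lia].
rewrite (@sum_haar_affine _ _ _ (c + s * (2 * p)%N%:Z) s); [by rewrite subrr|lia|].
by move=> t lt_t; rewrite -addnA affF; [rewrite PoszD; ring|lia].
Qed.

(** Intervals of equal length at different positions are disjoint. For even [e] the kinks of the
    tent are multiples of [4 p], so the short interval lies in one of the four pieces: left of the
    tent, falling, rising, or right of it. *)
Lemma tent_affine (b p b' p' e a a' : nat) :
  b = (4 * p * a)%N -> p' = (p * e)%N -> b' = (4 * p' * a')%N ->
  (e = 1 /\ a <> a')%N \/ (exists z, e = 2 * z)%N ->
  exists c s, forall t, (t < 4 * p)%N -> tent b' (2 * p') (b + t) = c + s * t%:Z.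
Proof.
move=> -> -> -> H.
have [h|[h|[h|h]]] : (4 * p * a + 4 * p <= 4 * (p * e) * a' \/
    (4 * (p * e) * a' <= 4 * p * a /\ 4 * p * a + 4 * p <= 4 * (p * e) * a' + 2 * (p * e)) \/
    (4 * (p * e) * a' + 2 * (p * e) <= 4 * p * a /\ 4 * p * a + 4 * p <= 4 * (p * e) * a' + 4 * (p * e)) \/
    4 * (p * e) * a' + 4 * (p * e) <= 4 * p * a)%N.
- case: H => [[-> /eqP]|[z ->]].
    rewrite neq_ltn => /orP[] h; [left|do 3!right]; nia.
  have [h|h] := leqP (2 * z * a') a; last by left; nia.
  have [h1|h1] := leqP (2 * z * a' + z) a; last by right; left; split; nia.
  have [h2|h2] := leqP (2 * z * a' + 2 * z) a; last by do 2!right; left; split; nia.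
  by do 3!right; nia.
- by exists 0, 0 => t lt_t; rewrite /tent; lia.
- exists ((4 * (p * e) * a')%N%:Z - (4 * p * a)%N%:Z), (-1) => t lt_t; rewrite /tent; lia.
- exists ((4 * p * a)%N%:Z - (4 * (p * e) * a' + 4 * (p * e))%N%:Z), 1 => t lt_t; rewrite /tent; lia.
- by exists 0, 0 => t lt_t; rewrite /tent; lia.
Qed.

Lemma quarters_tent0 (m b p b' p' e a a' : nat) :
  b = (4 * p * a)%N -> p' = (p * e)%N -> b' = (4 * p' * a')%N ->
  (e = 1 /\ a <> a')%N \/ (exists z, e = 2 * z)%N -> (b + 4 * p <= m)%N ->
  \sum_(w < m) quarters b p w * tent b' (2 * p') w = 0.
Proof.
move=> h1 h2 h3 h4 le_m; have [c [s affT]] := tent_affine h1 h2 h3 h4.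
exact: (sum_quarters_affine le_m affT).
Qed.

(** The two halves of the pattern meet the two opposite slopes of the tent, so their contributions
    [p ^ 2] add up instead of cancelling. *)
Lemma quarters_tent (m b p : nat) : (b + 4 * p <= m)%N ->
  \sum_(w < m) quarters b p w * tent b (2 * p) w = (2 * p ^ 2)%N%:Z.
Proof.
move=> le_m; rewrite sum_quarters.
rewrite (@sum_haar_affine _ _ _ 0 (-1)); [|lia|by move=> t lt_t; rewrite /tent; lia].
rewrite (@sum_haar_affine _ _ _ (- (2 * p)%N%:Z) 1); [|lia|by move=> t lt_t; rewrite /tent; lia].
by rewrite PoszM -[(p ^ 2)%N]/(p * p)%N !PoszM; ring.
Qed.

(** All breakpoints of the coarser function are multiples of [2 p]. *)
Lemma haar_constant (p b b' q' x y z : nat) :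
  b = (2 * p * x)%N -> b' = (2 * p * y)%N -> q' = (2 * p * z)%N ->
  exists c, forall t, (t < 2 * p)%N -> haar b' q' (b + t) = c.
Proof.
move=> -> -> ->.
have [h|h] := leqP y x; last by exists 0 => t lt_t; rewrite /haar; nia.
have [h1|h1] := leqP (y + z) x; last first.
  exists 1 => t lt_t; rewrite /haar.
  have : (2 * p * x + t < 2 * p * y + 2 * p * z)%N by nia.
  have : (2 * p * y <= 2 * p * x + t)%N by nia.
  lia.
have : (2 * p * y + 2 * p * z <= 2 * p * x)%N by nia.
have [h2|h2] := leqP (y + 2 * z) x; last first.
  have : (2 * p * x + 2 * p <= 2 * p * y + 2 * (2 * p * z))%N by nia.
  by exists (-1) => t lt_t; rewrite /haar; lia.
have : (2 * p * y + 2 * (2 * p * z) <= 2 * p * x)%N by nia.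
by exists 0 => t lt_t; rewrite /haar; lia.
Qed.

(** In both cases the second function is constant on the support of the first, which has mean
    zero. *)
Lemma haar_orthogonal (m b q b' q' e a a' : nat) :
  b = (2 * q * a)%N -> q' = (q * e)%N -> b' = (2 * q' * a')%N ->
  (e = 1 /\ a <> a')%N \/ (exists z, e = 2 * z)%N -> (b + 2 * q <= m)%N ->
  \sum_(x < m) haar b q x * haar b' q' x = 0.
Proof.
move=> hb hq hb' H le_m.
have [c constF] : exists c, forall t, (t < 2 * q)%N -> haar b' q' (b + t) = c.
  case: H => [[he na]|[z hz]].
    exists 0 => t lt_t; rewrite /haar hb hb' hq he muln1.
    have [h|h] := ltnP a a'; nia.
  by apply: (haar_constant (x := a) (y := (2 * z * a')) (z := z)); nia.
by rewrite (@sum_haar_affine _ _ _ c 0) ?mul0r ?oppr0 // => t lt_t; rewrite mul0r addr0 constF.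
Qed.

Lemma haar_sqr (m b q : nat) : (b + 2 * q <= m)%N ->
  \sum_(x < m) haar b q x * haar b q x = (2 * q)%N%:Z.
Proof.
move=> le_m; rewrite sum_haar // (eq_bigr (fun=> 2)) => [|t _].
  by rewrite sumr_const card_ord -mulr_natl natz; lia.
by have := ltn_ord t; rewrite /haar; lia.
Qed.

(** The second pattern is constant on each half of the first interval, and on each half the first
    pattern is, up to sign, a Haar function. *)
Lemma quarters_orthogonal (m b p b' p' e a a' : nat) :
  b = (4 * p * a)%N -> p' = (p * e)%N -> b' = (4 * p' * a')%N ->
  (e = 1 /\ a <> a')%N \/ (exists z, e = 2 * z)%N -> (b + 4 * p <= m)%N ->
  \sum_(x < m) quarters b p x * quarters b' p' x = 0.
Proof.
move=> hb hp hb' H le_m; rewrite sum_quarters.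
have constF x : (x = b \/ x = b + 2 * p)%N ->
    exists c, forall t, (t < 2 * p)%N -> quarters b' p' (x + t) = c.
  move=> hx; case: H => [[he na]|[z hz]].
    exists 0 => t lt_t; rewrite /quarters /haar.
    by have [h|h] := ltnP a a'; nia.
  have [y hy] : exists y, x = (2 * p * y)%N.
    by case: hx => ->; [exists (2 * a)%N|exists (2 * a + 1)%N]; rewrite hb; ring.
  have hp' : p' = (2 * p * z)%N by rewrite hp hz; ring.
  have hb1 : b' = (2 * p * (4 * z * a'))%N by rewrite hb' hp'; ring.
  have hb2 : (b' + 2 * p' = 2 * p * (4 * z * a' + 2 * z))%N by rewrite hb1 hp'; ring.
  have [c1 h1] := haar_constant hy hb1 hp'.
  have [c2 h2] := haar_constant hy hb2 hp'.
  exists (c1 - c2) => t lt_t; by rewrite /quarters h1 ?h2.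
have [|c1 h1] := constF b; first by left.
have [|c2 h2] := constF (b + 2 * p)%N; first by right.
rewrite (@sum_haar_affine _ _ _ c1 0); [|lia|by move=> t ?; rewrite mul0r addr0 h1].
rewrite (@sum_haar_affine _ _ _ c2 0); [|lia|by move=> t ?; rewrite mul0r addr0 h2].
by rewrite !mul0r subrr.
Qed.

Lemma quarters_sqr (m b p : nat) : (b + 4 * p <= m)%N ->
  \sum_(x < m) quarters b p x * quarters b p x = (4 * p)%N%:Z.
Proof.
move=> le_m; rewrite sum_quarters !sum_haar; try lia.
rewrite (eq_bigr (fun=> 2)) => [|t _]; last first.
  by have := ltn_ord t; rewrite /quarters /haar; lia.
rewrite [X in _ - X](eq_bigr (fun=> -2)) => [|t _]; last first.
  by have := ltn_ord t; rewrite /quarters /haar; lia.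
rewrite !sumr_const card_ord mulNrn opprK -mulrnDl -[4%N]/(2 + 2)%N mulnDl.
by rewrite PoszD PoszM -[2%:Z]/(2 : int) mulrDl -mulr_natr natz; ring.
Qed.

(** Level [j] and position [a] name a dyadic interval of length [4 * 2 ^ (s - j)] in a grid of side
    [4 * 2 ^ s]. The factor 4 leaves room for four quarters even at the finest level [s]. *)
Definition haar_at (s j a : nat) := haar (4 * 2 ^ (s - j) * a) (2 * 2 ^ (s - j)).
Definition quarters_at (s j a : nat) := quarters (4 * 2 ^ (s - j) * a) (2 ^ (s - j)).

Lemma level_bound (s j a : nat) : (j <= s)%N -> (a < 2 ^ j)%N ->
  (4 * 2 ^ (s - j) * a + 4 * 2 ^ (s - j) <= 4 * 2 ^ s)%N.
Proof.
by move=> le_js lt_a; rewrite -{3}(subnK le_js) expnD; nia.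
Qed.

(** Supplies the alternative assumed by [tent_affine] and the orthogonality lemmas, with
    [e = 2 ^ (j - j')]. *)
Lemma level_ratio (s j j' a a' : nat) : (j' <= j)%N -> (j <= s)%N -> (j, a) != (j', a') ->
  exists e, (2 ^ (s - j') = 2 ^ (s - j) * e)%N /\
  ((e = 1 /\ a <> a') \/ exists z, e = 2 * z)%N.
Proof.
move=> le_jj le_js ne; exists (2 ^ (j - j'))%N; split.
  by rewrite -expnD; congr (2 ^ _)%N; lia.
case: (ltngtP j' j) le_jj => // [lt_j|eq_j] _.
  by right; exists (2 ^ (j - j').-1)%N; rewrite -expnS; congr (2 ^ _)%N; lia.
by left; rewrite eq_j subnn; split=> // eqa; move: ne; rewrite eq_j eqa eqxx.
Qed.

Section Levels.
Variables s j a j' a' : nat.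
Hypotheses (le_js : (j <= s)%N) (lt_a : (a < 2 ^ j)%N).
Hypotheses (le_js' : (j' <= s)%N) (lt_a' : (a' < 2 ^ j')%N).
Let m := (4 * 2 ^ s)%N.

Lemma quarters_tent_at :
  \sum_(w < m) \sum_(y < m) quarters_at s j a w * ((w <= y)%N%:Z * haar_at s j' a' y) =
  \sum_(w < m) quarters_at s j a w * tent (4 * 2 ^ (s - j') * a') (2 * 2 ^ (s - j')) w.
Proof.
apply: eq_bigr => w _; rewrite -mulr_sumr; congr (_ * _).
by apply: sum_prefix_haar; have := level_bound le_js' lt_a'; rewrite /m; lia.
Qed.

(** Unlike orthogonality this is one-sided: a pattern on a longer interval can detect a tent inside
    one of its quarters. *)
Lemma quarters_tent_at0 : (j' <= j)%N -> (j, a) != (j', a') ->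
  \sum_(w < m) \sum_(y < m) quarters_at s j a w * ((w <= y)%N%:Z * haar_at s j' a' y) = 0.
Proof.
move=> le_jj ne; rewrite quarters_tent_at.
have [e [he h]] := level_ratio le_jj le_js ne.
exact: (quarters_tent0 (e := e) (a := a) (a' := a') _ he _ h (level_bound le_js lt_a)).
Qed.

Lemma haar_at_orthogonal_le : (j' <= j)%N -> (j, a) != (j', a') ->
  \sum_(w < m) haar_at s j a w * haar_at s j' a' w = 0.
Proof.
move=> le_jj ne; have [e [he h]] := level_ratio le_jj le_js ne.
by apply: (haar_orthogonal (e := e) (a := a) (a' := a') _ _ _ h);
  have := level_bound le_js lt_a; rewrite ?he /m; nia.
Qed.

Lemma quarters_at_orthogonal_le : (j' <= j)%N -> (j, a) != (j', a') ->
  \sum_(w < m) quarters_at s j a w * quarters_at s j' a' w = 0.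
Proof.
move=> le_jj ne; have [e [he h]] := level_ratio le_jj le_js ne.
exact: (quarters_orthogonal (e := e) (a := a) (a' := a') _ he _ h (level_bound le_js lt_a)).
Qed.

End Levels.

Section Orthogonality.
Variables s j a j' a' : nat.
Hypotheses (le_js : (j <= s)%N) (lt_a : (a < 2 ^ j)%N).
Hypotheses (le_js' : (j' <= s)%N) (lt_a' : (a' < 2 ^ j')%N).
Let m := (4 * 2 ^ s)%N.

Lemma haar_at_orthogonal :
  \sum_(w < m) haar_at s j a w * haar_at s j' a' w =
  (4 * 2 ^ (s - j))%N%:Z *+ ((j, a) == (j', a')).
Proof.
have [[<- <-]|ne] := eqVneq.
  by rewrite haar_sqr [(2 * (2 * _))%N]mulnA // level_bound.
have [le_jj|/ltnW le_jj] := leqP j' j; first by rewrite haar_at_orthogonal_le.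
under eq_bigr do rewrite mulrC.
by rewrite haar_at_orthogonal_le // eq_sym.
Qed.

Lemma quarters_at_orthogonal :
  \sum_(w < m) quarters_at s j a w * quarters_at s j' a' w =
  (4 * 2 ^ (s - j))%N%:Z *+ ((j, a) == (j', a')).
Proof.
have [[<- <-]|ne] := eqVneq; first by rewrite quarters_sqr ?level_bound.
have [le_jj|/ltnW le_jj] := leqP j' j; first by rewrite quarters_at_orthogonal_le.
under eq_bigr do rewrite mulrC.
by rewrite quarters_at_orthogonal_le // eq_sym.
Qed.

Lemma quarters_tent_at_diag :
  \sum_(w < m) \sum_(y < m) quarters_at s j a w * ((w <= y)%N%:Z * haar_at s j a y) =
  (2 * (2 ^ (s - j)) ^ 2)%N%:Z.
Proof. by rewrite quarters_tent_at // quarters_tent // level_bound. Qed.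

End Orthogonality.

(** * Dyadic boxes of equal volume *)

(** Both sides are compared with [2k (2k - 1) ... (k + 1)], which is [k!] times a central binomial
    coefficient. *)
Lemma expn_self_le_fact (k : nat) : (k ^ k <= 4 ^ k * k`!)%N.
Proof.
have h1 : ('C(2 * k, k) <= 4 ^ k)%N.
  have -> : (4 ^ k = (1 + 1) ^ (2 * k))%N by rewrite expnM.
  rewrite expnDn; under eq_bigr do rewrite !exp1n !muln1.
  have lt_k : (k < (2 * k).+1)%N by lia.
  by rewrite (bigD1 (Ordinal lt_k)) //= leq_addr.
have h2 : (k ^ k <= (2 * k) ^_ k)%N.
  rewrite ffact_prod -{2}[k]card_ord -prod_nat_const.
  by apply: leq_prod => i _; have := ltn_ord i; lia.
by rewrite (leq_trans h2) // -bin_ffact leq_mul2r h1 orbT.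
Qed.

Lemma sum_ffun_prod (R : comPzRingType) (I J : finType) (F : I -> J -> R) :
  \sum_(w : {ffun I -> J}) \prod_i F i (w i) = \prod_i \sum_x F i x.
Proof. by rewrite bigA_distr_bigA. Qed.

Definition dominance (d m : nat) (w y : {ffun 'I_d -> 'I_m}) : bool :=
  [forall i, (w i <= y i)%N].

Section Tensor.
Variables (d s : nat).
Let m := (4 * 2 ^ s)%N.
Let T := {ffun 'I_d -> 'I_m}.
Let box := ({ffun 'I_d -> 'I_s.+1} * {ffun 'I_d -> 'I_(2 ^ s)})%type.
Implicit Types rho sigma : box.

(* A pair of levels and positions, encoding a dyadic box of volume [2 ^ - s]. *)
Definition dyadic_box rho :=
  (\sum_i rho.1 i == s)%N && [forall i, (rho.2 i < 2 ^ rho.1 i)%N].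

Definition tensor_haar rho (y : T) : int := \prod_i haar_at s (rho.1 i) (rho.2 i) (y i).
Definition tensor_quarters rho (y : T) : int :=
  \prod_i quarters_at s (rho.1 i) (rho.2 i) (y i).

Lemma level_le rho (i : 'I_d) : (rho.1 i <= s)%N.
Proof. by rewrite -ltnS. Qed.

Lemma prod_level_size rho : dyadic_box rho ->
  (\prod_i (4 * 2 ^ (s - rho.1 i)) * 2 ^ s = 4 ^ d * (2 ^ s) ^ d)%N.
Proof.
case/andP => /eqP eqs _; have eq2 : (2 ^ s = \prod_i 2 ^ rho.1 i)%N by rewrite -expn_sum eqs.
rewrite [X in (_ * X = _)%N]eq2 -big_split /=.
rewrite (eq_bigr (fun=> 4 * 2 ^ s)%N) => [|i _].
  by rewrite prod_nat_const card_ord expnMn.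
by rewrite -mulnA -expnD subnK ?level_le.
Qed.

(** The number of grid points in a dyadic box, the same for all boxes because their levels sum to
    [s]. It is also the squared norm of the tensor functions. *)
Let r := (4 ^ d * (2 ^ s) ^ d %/ 2 ^ s)%N.

Lemma volumeE rho : dyadic_box rho -> (\prod_i (4 * 2 ^ (s - rho.1 i)) = r)%N.
Proof. by move=> /prod_level_size; rewrite /r => <-; rewrite mulnK ?expn_gt0. Qed.

Lemma box_eqP rho sigma :
  reflect (forall i, (rho.1 i : nat, rho.2 i : nat) = (sigma.1 i : nat, sigma.2 i : nat))
    (rho == sigma).
Proof.
apply: (iffP eqP) => [-> //|eqi].
by rewrite [rho]surjective_pairing [sigma]surjective_pairing; congr (_, _);
  apply/ffunP => i; apply: val_inj; case: (eqi i).
Qed.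

Lemma box_neqP rho sigma : rho != sigma ->
  exists i, (rho.1 i : nat, rho.2 i : nat) != (sigma.1 i : nat, sigma.2 i : nat).
Proof.
move=> ne; apply/existsP; apply: contraNT ne; rewrite negb_exists => /forallP h.
by apply/box_eqP => i; apply/eqP; have := h i; rewrite negbK.
Qed.

Lemma tensor_haar_orthogonal rho sigma : dyadic_box rho -> dyadic_box sigma ->
  \sum_y tensor_haar rho y * tensor_haar sigma y = r%:R *+ (rho == sigma).
Proof.
move=> Prho Psigma; under eq_bigr do rewrite -big_split /=.
have /andP[_ /forallP lt_rho] := Prho; have /andP[_ /forallP lt_sigma] := Psigma.
rewrite (sum_ffun_prod (fun i (x : 'I_m) => haar_at s (rho.1 i) (rho.2 i) x *
   haar_at s (sigma.1 i) (sigma.2 i) x)).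
under eq_bigr do rewrite haar_at_orthogonal ?level_le //.
have [<-|/box_neqP[i ne]] := eqVneq rho sigma; last first.
  by rewrite (bigD1 i) //= (negPf ne) mul0r.
by rewrite -(volumeE Prho) natr_prod; apply: eq_bigr => i _; rewrite eqxx natz.
Qed.

Lemma tensor_quarters_orthogonal rho sigma : dyadic_box rho -> dyadic_box sigma ->
  \sum_y tensor_quarters rho y * tensor_quarters sigma y = r%:R *+ (rho == sigma).
Proof.
move=> Prho Psigma; under eq_bigr do rewrite -big_split /=.
have /andP[_ /forallP lt_rho] := Prho; have /andP[_ /forallP lt_sigma] := Psigma.
rewrite (sum_ffun_prod (fun i (x : 'I_m) => quarters_at s (rho.1 i) (rho.2 i) x *
   quarters_at s (sigma.1 i) (sigma.2 i) x)).
under eq_bigr do rewrite quarters_at_orthogonal ?level_le //.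
have [<-|/box_neqP[i ne]] := eqVneq rho sigma; last first.
  by rewrite (bigD1 i) //= (negPf ne) mul0r.
by rewrite -(volumeE Prho) natr_prod; apply: eq_bigr => i _; rewrite eqxx natz.
Qed.

Lemma dominance_prod (w y : T) : (dominance w y)%:R = \prod_i (w i <= y i)%N%:Z :> int.
Proof.
rewrite /dominance; case: forallP => [h|/forallP].
  by rewrite big1 // => i _; rewrite h.
by rewrite negb_forall => /existsP[i /negPf ni]; rewrite (bigD1 i) //= ni mul0r.
Qed.

Lemma tensor_bilinear rho sigma :
  \sum_w \sum_y tensor_quarters rho w * ((dominance w y)%:R * tensor_haar sigma y) =
  \prod_i \sum_(w < m) \sum_(y < m) quarters_at s (rho.1 i) (rho.2 i) w *
     ((w <= y)%N%:Z * haar_at s (sigma.1 i) (sigma.2 i) y).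
Proof.
rewrite -sum_ffun_prod; apply: eq_bigr => w _; rewrite -sum_ffun_prod; apply: eq_bigr => y _.
by rewrite dominance_prod -!big_split.
Qed.

(** A coordinate with quarter length [p] contributes [2 p ^ 2 = (4 p) ^ 2 / 8]. *)
Lemma tensor_diagonal rho : dyadic_box rho ->
  \sum_w \sum_y tensor_quarters rho w * ((dominance w y)%:R * tensor_haar rho y) =
  (r ^ 2 %/ 8 ^ d)%N%:Z.
Proof.
move=> Prho; have /andP[_ /forallP lt_rho] := Prho; rewrite tensor_bilinear.
under eq_bigr do rewrite quarters_tent_at_diag ?level_le //.
rewrite -(volumeE Prho) expnS expn1 -big_split /=.
rewrite (eq_bigr (fun i => 8 * (2 * (2 ^ (s - rho.1 i)) ^ 2)))%N => [|i _]; last by ring.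
rewrite big_split /= prod_nat_const card_ord mulKn ?expn_gt0 //.
by rewrite -!natz natr_prod; apply: eq_bigr => i _; rewrite natz.
Qed.

Lemma volume_sqr rho : dyadic_box rho -> (8 ^ d * (r ^ 2 %/ 8 ^ d) = r ^ 2)%N.
Proof.
move=> Prho; rewrite mulnC divnK // -(volumeE Prho) expnS expn1 -big_split /=.
rewrite (eq_bigr (fun i => 8 * (2 * (2 ^ (s - rho.1 i)) ^ 2)))%N => [|i _]; last by ring.
by rewrite big_split /= prod_nat_const card_ord dvdn_mulr.
Qed.

(* Boxes of equal volume are never strictly nested. *)
Lemma tensor_off_diagonal rho sigma : dyadic_box rho -> dyadic_box sigma -> rho != sigma ->
  \sum_w \sum_y tensor_quarters rho w * ((dominance w y)%:R * tensor_haar sigma y) = 0.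
Proof.
move=> Prho Psigma ne; rewrite tensor_bilinear.
have /andP[/eqP sum_rho /forallP lt_rho] := Prho.
have /andP[/eqP sum_sigma /forallP lt_sigma] := Psigma.
suff [i [le_i ne_i]] : exists i, (sigma.1 i <= rho.1 i)%N /\
    (rho.1 i : nat, rho.2 i : nat) != (sigma.1 i : nat, sigma.2 i : nat).
  by rewrite (bigD1 i) //= quarters_tent_at0 ?mul0r ?level_le.
have [i ne_i] := box_neqP ne.
have [le_i|lt_i] := leqP (sigma.1 i) (rho.1 i); first by exists i.
(* Both level sums equal [s], so a coordinate where [sigma] is finer forces another one where it is
   coarser. *)
have [j lt_j] : exists j, (sigma.1 j < rho.1 j)%N.
  apply/existsP; rewrite -[X in is_true X]negbK negb_exists; apply/negP => /forallP le_all.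
  have : (\sum_j rho.1 j < \sum_j sigma.1 j)%N.
    rewrite (bigD1 i) //= [in X in (_ < X)%N](bigD1 i) //= -addSn leq_add //.
    by apply: leq_sum => j _; rewrite leqNgt le_all.
  by rewrite sum_rho sum_sigma ltnn.
exists j; split; first exact: ltnW.
by apply/eqP => -[eq_j _]; rewrite eq_j ltnn in lt_j.
Qed.

Lemma card_grid rho : dyadic_box rho -> #|{: T}| = (r * 2 ^ s)%N.
Proof.
move=> Prho; rewrite card_ffun !card_ord -(volumeE Prho) prod_level_size //.
by rewrite expnMn.
Qed.

(** With [q = r ^ 2 / 8 ^ d] on the diagonal and [r * 2 ^ s] grid points, [det_sandwich_le] gives
    [k! q ^ k <= (2 D * 2 ^ s * r ^ 2) ^ k]. Replacing [k!] by [(k / 4) ^ k] and taking [k]-th roots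
    bounds [k]. *)
Lemma card_dyadic_box_le (D : nat) :
  (forall k (f g : 'I_k -> T),
     (`|\det (\matrix_(i, j) ((dominance (f i) (g j))%:R : int))%R| <= (2 * D) ^ k)%N) ->
  (#|dyadic_box| <= 8 ^ d.+1 * 2 ^ s * D)%N.
Proof.
move=> leD; set k := #|dyadic_box|.
have [->//|k_gt0] := posnP k.
have [rho0 Prho0] := card_gt0P k_gt0.
pose rho (i : 'I_k) : box := enum_val i.
have Prho i : dyadic_box (rho i) by apply: (enum_valP i).
have rhoK i j : (rho i == rho j) = (i == j) by rewrite (inj_eq enum_val_inj).
have orthU : orthogonal_rows r (fun i => tensor_quarters (rho i)).
  by move=> i j; rewrite tensor_quarters_orthogonal // rhoK.
have orthW : orthogonal_rows r (fun i => tensor_haar (rho i)).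
  by move=> i j; rewrite tensor_haar_orthogonal // rhoK.
have := det_sandwich_le (A := fun w y => (dominance w y)%:R) orthU orthW (leD k).
set q := (r ^ 2 %/ 8 ^ d)%N.
have -> : \matrix_(i, j) (\sum_t \sum_u tensor_quarters (rho i) t *
    ((dominance t u)%:R * tensor_haar (rho j) u)) = (q%:Z)%:M :> 'M[int]_k.
  apply/matrixP => i j; rewrite !mxE -rhoK.
  have [->|ne] := eqVneq (rho i) (rho j); first by rewrite tensor_diagonal.
  by rewrite tensor_off_diagonal.
rewrite det_scalar abszX /= (card_grid Prho0) => le_q.
have q_gt0 : (0 < q)%N.
  have := volume_sqr Prho0; rewrite -/q; case: (posnP q) => // ->.
  rewrite muln0 => /esym/eqP; rewrite expn_eq0 andbT -(volumeE Prho0).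
  rewrite -leqn0 leqNgt prodn_gt0 // => i; by rewrite muln_gt0 expn_gt0.
rewrite -(leq_exp2r _ _ k_gt0).
apply: leq_trans (expn_self_le_fact k) _.
have qk_gt0 : (0 < q ^ k)%N by rewrite expn_gt0 q_gt0.
rewrite -(leq_pmul2r qk_gt0) -mulnA.
apply: leq_trans (leq_mul (leqnn _) le_q) _.
rewrite -!expnMn leq_exp2r // leq_eqVlt; apply/orP; left; apply/eqP.
transitivity (8 * 2 ^ s * D * r ^ 2)%N; first by ring.
by rewrite -(volume_sqr Prho0) -/q expnS; ring.
Qed.
End Tensor.

(** All levels but the first are chosen freely in [0..u], and the first completes the sum to [s].
    Every such choice admits [2 ^ s] positions. *)
Lemma card_dyadic_box_ge (d u : nat) :
  (2 ^ (d.+1 * u) * u.+1 ^ d <= #|@dyadic_box d.+1 (d.+1 * u)|)%N.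
Proof.
set s := (d.+1 * u)%N.
pose lam (f : {ffun 'I_d -> 'I_u.+1}) : {ffun 'I_d.+1 -> 'I_s.+1} :=
  [ffun i => if unlift ord0 i is Some j then inord (f j) else inord (s - \sum_j f j)].
have sum_le f : (\sum_(j < d) (f : {ffun 'I_d -> 'I_u.+1}) j <= s)%N.
  apply: (@leq_trans (d * u)); last by rewrite /s mulSn leq_addl.
  have -> : (d * u = \sum_(j < d) u)%N by rewrite sum_nat_const card_ord.
  apply: leq_sum => j _.
  by rewrite -ltnS.
have lamS f j : lam f (lift ord0 j) = f j :> nat.
  rewrite ffunE liftK inordK // ltnS (leq_trans _ (_ : u <= s)%N) //.
    by rewrite -ltnS.
  by rewrite /s mulSn leq_addr.
have lam0 f : lam f ord0 = (s - \sum_j f j)%N :> nat.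
  by rewrite ffunE unlift_none inordK // ltnS leq_subr.
have sum_lam f : (\sum_i lam f i = s)%N.
  rewrite big_ord_recl; under eq_bigr do rewrite lamS.
  by rewrite lam0 subnK.
have lam_inj : injective lam.
  move=> f g eq_fg; apply/ffunP => j; apply: val_inj; by rewrite /= -(lamS f) -(lamS g) eq_fg.
pose pos f := [set a : {ffun 'I_d.+1 -> 'I_(2 ^ s)} | [forall i, (a i < 2 ^ lam f i)%N]].
have card_pos f : #|pos f| = (2 ^ s)%N.
  transitivity (\prod_i 2 ^ lam f i)%N; last by rewrite -expn_sum sum_lam.
  have -> : #|pos f| = #|family (fun i => [pred x : 'I_(2 ^ s) | (x < 2 ^ lam f i)%N])|.
    apply: eq_card => a; rewrite inE; apply/forallP/familyP => h i; exact: (h i).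
  rewrite card_family foldrE big_map big_enum /=; apply: eq_bigr => i _.
  have le_i : (2 ^ lam f i <= 2 ^ s)%N by rewrite leq_exp2l // -ltnS.
  have inj : injective (widen_ord le_i) by move=> y z /(congr1 val) /= /val_inj.
  rewrite -[RHS]card_ord -(card_codom inj); apply: eq_card => x.
  rewrite [x \in _]unfold_in /=; apply/idP/codomP => [lt_x|[y ->]]; last exact: (ltn_ord y).
  by exists (Ordinal lt_x); apply: val_inj.
pose g (p : {ffun 'I_d -> 'I_u.+1} * 'I_(2 ^ s)) :=
  (lam p.1, enum_val (cast_ord (esym (card_pos p.1)) p.2)).
have g_inj : injective g.
  move=> [f t] [f' t'] [/lam_inj eqf]; case: _ / eqf => /enum_val_inj/cast_ord_inj.
  by move=> ->.
have <- : #|codom g| = (2 ^ s * u.+1 ^ d)%N.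
  by rewrite card_codom // card_prod card_ffun !card_ord mulnC.
apply/subset_leq_card/fintype.subsetP => _ /codomP[[f t] ->].
rewrite unfold_in /dyadic_box /= sum_lam eqxx /=.
by have := enum_valP (cast_ord (esym (card_pos f)) t); rewrite inE.
Qed.

Lemma hereditary_grid_lower_bound (d u D : nat) :
  (forall k (f g : 'I_k -> {ffun 'I_d.+1 -> 'I_(4 * 2 ^ (d.+1 * u))}),
     injective g ->
     hereditary_disc_le (\matrix_(i, j) ((dominance (f i) (g j))%:R : int)) D) ->
  (u.+1 ^ d <= 8 ^ d.+2 * D)%N.
Proof.
move=> herD; have pos : (0 < 2 ^ (d.+1 * u))%N by rewrite expn_gt0.
rewrite -(leq_pmul2l pos); apply: leq_trans (card_dyadic_box_ge d u) _.
rewrite mulnCA mulnA; apply: card_dyadic_box_le => k f g.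
(* A repeated column makes the minor vanish, so the hypothesis on injective [g] covers all
   minors. *)
have [/injectiveP inj_g|/injectivePn[i [j ne eq_g]]] := boolP (injectiveb g).
  exact/det_le_hereditary_disc/herD.
rewrite -det_tr (determinant_alternate ne) // => l.
by rewrite !mxE eq_g.
Qed.

Local Open Scope classical_set_scope.
Local Open Scope ring_scope.

(** * Flag coordinates of a polytope *)

Section Geometry.
Variables (R : realType) (d : nat).
Implicit Types (S B : set 'rV[R]_d) (f : 'rV[R]_d -> R).

Definition affine_fun f := forall n (a : 'I_n -> R) (p : 'I_n -> 'rV[R]_d),
  \sum_i a i = 1 -> f (\sum_i a i *: p i) = \sum_i a i * f (p i).

Lemma affine_fun_dot (a : 'rV[R]_d) (c : R) :
  affine_fun (fun x => c - \sum_i a 0 i * x 0 i).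
Proof.
move=> n b p sum_b; rewrite -[c in LHS]mul1r -sum_b mulr_suml.
have -> : \sum_i a 0 i * (\sum_(j < n) b j *: p j) 0 i =
    \sum_(j < n) b j * \sum_i a 0 i * p j 0 i.
  under [RHS]eq_bigr do rewrite mulr_sumr.
  rewrite exchange_big; apply: eq_bigr => i _ /=.
  by rewrite summxE mulr_sumr; apply: eq_bigr => j _; rewrite mxE mulrCA.
by rewrite -sumrB; apply: eq_bigr => j _; rewrite mulrBr.
Qed.

Lemma affine_funD f g (c K : R) : affine_fun f -> affine_fun g ->
  affine_fun (fun x => f x - c + K * g x).
Proof.
move=> aff_f aff_g n a p sum_a; rewrite aff_f // aff_g //.
rewrite -[c in LHS]mul1r -{1}sum_a mulr_suml mulr_sumr -sumrB -big_split /=.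
by apply: eq_bigr => i _; ring.
Qed.

Lemma affine_fun_hull_ge0 S f : affine_fun f -> (forall x, S x -> 0 <= f x) ->
  forall x, convex_hull S x -> 0 <= f x.
Proof.
move=> aff_f f_ge0 x [n [a [p [Sp a_ge0 sum_a ->]]]].
by rewrite aff_f //; apply: sumr_ge0 => i _; rewrite mulr_ge0 ?f_ge0.
Qed.

Lemma convex_hull_seq (s : seq 'rV[R]_d) x :
  convex_hull [set` s] x <-> exists b : 'I_(size s) -> R,
    [/\ forall j, 0 <= b j, \sum_j b j = 1 & x = \sum_j b j *: nth 0 s j].
Proof.
split=> [[n [a [p [Sp a_ge0 sum_a ->]]]]|[b [b_ge0 sum_b ->]]]; last first.
  by exists (size s), b, (fun j => nth 0 s j); split=> // i; rewrite /= mem_nth.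
have idx i : (index (p i) s < size s)%N by rewrite index_mem; apply: Sp.
pose phi i := Ordinal (idx i).
exists (fun j => \sum_(i | phi i == j) a i); split.
- by move=> j; apply: sumr_ge0.
- by rewrite -sum_a [RHS](partition_big phi xpredT).
- rewrite (partition_big phi xpredT) //=; apply: eq_bigr => j _.
  rewrite scaler_suml; apply: eq_bigr => i /eqP <-.
  by rewrite nth_index //; apply: Sp.
Qed.

Lemma convex_hull_idem S n (a : 'I_n -> R) (p : 'I_n -> 'rV[R]_d) : finite_set S ->
  (forall i, convex_hull S (p i)) -> (forall i, 0 <= a i) -> \sum_i a i = 1 ->
  convex_hull S (\sum_i a i *: p i).
Proof.
move=> /finite_seqP[s ->] hull_p a_ge0 sum_a.
have /choice[b bP] i := (convex_hull_seq s (p i)).1 (hull_p i).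
apply/convex_hull_seq; exists (fun j => \sum_i a i * b i j); split.
- move=> j; apply: sumr_ge0 => i _; have [b_ge0 _ _] := bP i.
  by rewrite mulr_ge0.
- rewrite exchange_big -[RHS]sum_a; apply: eq_bigr => i _ /=.
  by have [_ sum_b _] := bP i; rewrite -mulr_sumr sum_b mulr1.
- under [RHS]eq_bigr do rewrite scaler_suml.
  rewrite [RHS]exchange_big; apply: eq_bigr => i _ /=.
  have [_ _ ->] := bP i; rewrite scaler_sumr.
  by apply: eq_bigr => j _; rewrite scalerA.
Qed.

Lemma has_dim_inj S k k' : has_dim S k -> has_dim S k' -> k = k'.
Proof.
move=> [x [U [<- eqU]]] [y [W [<- eqW]]]; move: eqU; rewrite {}eqW => eqUW.
suff -> : U = W by [].
have sub (x' y' : 'rV[R]_d) (U' W' : {vspace 'rV[R]_d}) :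
    [set x' + u | u in [set` U']] = [set y' + u | u in [set` W']] -> (U' <= W')%VS.
  move=> eqs.
  have [w0 W0 e0] : [set y' + u | u in [set` W']] x'.
    by rewrite -eqs; exists 0; rewrite ?addr0 //= mem0v.
  apply/subvP => u Uu.
  have [w Ww ew] : [set y' + u | u in [set` W']] (x' + u) by rewrite -eqs; exists u.
  suff -> : u = w - w0 by rewrite memvB.
  by rewrite -[u](addKr x') -ew -e0 opprD addrACA addNr add0r addrC.
by apply/eqP; rewrite eqEsubv (sub _ _ _ _ (esym eqUW)) (sub _ _ _ _ eqUW).
Qed.

Lemma has_dim_neq0 S k : has_dim S k -> S !=set0.
Proof.
move=> [x [U [_ eqU]]].
have [n [a [p [Sp sum_a _]]]] : affine_hull S x.
  by rewrite eqU; exists 0; rewrite ?addr0 //= mem0v.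
case: n => [|n] in a p Sp sum_a; last by exists (p ord0).
by move: sum_a; rewrite big_ord0 => /esym/eqP; rewrite oner_eq0.
Qed.

Lemma has_dim1_two_points S : has_dim S 1 -> exists u w, [/\ S u, S w & u != w].
Proof.
move=> dimS; have [u Su] := has_dim_neq0 dimS.
apply: contrapT => no_w.
have S1 w : S w -> w = u.
  by move=> Sw; apply/eqP/negP => ne; apply: no_w; exists w, u; split=> //; apply/negP.
suff /(has_dim_inj dimS) : has_dim S 0 by [].
exists u, 0%VS; split; first by rewrite dimv0.
rewrite seteqP; split=> x /=.
  move=> [n [a [p [Sp sum_a ->]]]]; exists 0; first by rewrite mem0v.
  rewrite addr0 -[LHS]scale1r -sum_a scaler_suml.
  by apply: eq_bigr => i _; rewrite (S1 _ (Sp i)).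
move=> [v]; rewrite memv0 => /eqP -> <-; rewrite addr0.
by exists 1%N, (fun=> 1), (fun=> u); split=> //; rewrite big_ord1 ?scale1r.
Qed.

(** Any [y] is an affine combination of an interior point [x] and of a point of [B] close to [x] on
    the segment towards [y]. *)
Lemma has_dim_interior B : interior B !=set0 -> has_dim B d.
Proof.
move=> [x int_x].
exists 0, fullv; split; first by rewrite dimvf /dim /= mul1n.
rewrite seteqP; split=> y _; first by exists y; rewrite ?add0r //= memvf.
have /nbhs_ballP[e /= e_gt0 ballB] : nbhs x B := int_x.
pose v := y - x; pose s := e / (1 + `|v|).
have s_gt0 : 0 < s by rewrite divr_gt0 // ltr_wpDr.
have Bz : B (x + s *: v).
  apply: ballB; rewrite -ball_normE /= opprD addNKr normrN normrZ gtr0_norm //.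
  by rewrite /s mulrAC ltr_pdivrMr ?ltr_wpDr // ltr_pM2l // ltrDr.
have Bx : B x by apply: ballB; exact: ballxx.
exists 2%N, (fun i => if i == ord0 then 1 - s^-1 else s^-1),
  (fun i => if i == ord0 then x else x + s *: v); split.
- by move=> i; case: ifP.
- by rewrite !big_ord_recl big_ord0 /= addr0 subrK.
- rewrite !big_ord_recl big_ord0 /= addr0 scalerBl scale1r scalerDr scalerA mulVf ?gt_eqF //.
  by rewrite scale1r addrA subrK /v addrC subrK.
Qed.

(** [B] is caught between the standard simplex and a cone given by an upper triangular [N] with
    positive diagonal. For coordinates of rapidly decreasing size, both conditions amount to the
    signs of the coordinates. *)
Definition flag_coordinates B (v0 : 'rV[R]_d) (e : 'I_d -> 'rV[R]_d) (N : 'I_d -> 'I_d -> R) :=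
  [/\ forall x : 'I_d -> R, (forall i, 0 <= x i) -> \sum_i x i <= 1 ->
        B (v0 + \sum_i x i *: e i),
      forall j i : 'I_d, (i < j)%N -> N j i = 0,
      forall j, 0 < N j j &
      forall x : 'I_d -> R, B (v0 + \sum_i x i *: e i) ->
        forall j, 0 <= \sum_i N j i * x i].

Lemma simplex_combination (x : 'I_d -> R) (v : nat -> 'rV[R]_d) :
  exists a : 'I_d.+1 -> R, [/\ a ord0 = 1 - \sum_i x i,
    forall i, a (lift ord0 i) = x i, \sum_i a i = 1 &
    v 0%N + \sum_i x i *: (v i.+1 - v 0%N) = \sum_(i < d.+1) a i *: v i].
Proof.
pose a i : R := if unlift ord0 i is Some j then x j else 1 - \sum_i x i.
have a0 : a ord0 = 1 - \sum_i x i by rewrite /a unlift_none.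
have aS i : a (lift ord0 i) = x i by rewrite /a liftK.
exists a; split=> //.
  by rewrite big_ord_recl; under eq_bigr do rewrite aS; rewrite a0 subrK.
rewrite [RHS]big_ord_recl; under [in RHS]eq_bigr do rewrite aS; rewrite a0.
under [in LHS]eq_bigr do rewrite scalerBr.
by rewrite sumrB -scaler_suml scalerBl scale1r addrA addrAC.
Qed.

(** Since [al j] is affine and vanishes at [v 0], its value is [\sum_i x i * al j (v i.+1)]; its
    vanishing at [v 0, ..., v j] is the triangularity. *)
Lemma flag_coordinatesP B (al : nat -> 'rV[R]_d -> R) (v : nat -> 'rV[R]_d) :
  polytope B ->
  (forall j, (j < d)%N -> affine_fun (al j) /\ forall x, B x -> 0 <= al j x) ->
  (forall i, (i <= d)%N -> B (v i)) ->
  (forall i j, (i <= j < d)%N -> al j (v i) = 0) ->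
  (forall j, (j < d)%N -> 0 < al j (v j.+1)) ->
  flag_coordinates B (v 0%N) (fun i => v i.+1 - v 0%N) (fun j i => al j (v i.+1)).
Proof.
move=> [V finV ->] alP Bv al0 al_gt0; split.
- move=> x x_ge0 sum_x; have [a [a0 aS sum_a ->]] := simplex_combination x v.
  apply: convex_hull_idem => // i; first by apply: Bv; rewrite -ltnS.
  by case: (unliftP ord0 i) => [j|] ->; rewrite ?a0 ?aS // subr_ge0.
- by move=> j i lt_ij; apply: al0; rewrite lt_ij /=.
- by move=> j; apply: al_gt0.
- move=> x Bx j; have [aff al_ge0] := alP j (ltn_ord j).
  move: Bx; have [a [_ aS sum_a ->]] := simplex_combination x v => /al_ge0.
  rewrite aff // big_ord_recl al0 ?mulr0 ?add0r //=.
  by congr (0 <= _); apply: eq_bigr => i _; rewrite aS mulrC.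
Qed.

Lemma seq_min_exists (T : eqType) (s : seq T) (f : T -> R) : s != [::] ->
  exists2 x, x \in s & forall y, y \in s -> f x <= f y.
Proof.
elim: s => // x s IHs _; have [->|/IHs[y ys min_y]] := eqVneq s [::].
  by exists x; rewrite ?mem_head // => y; rewrite inE => /eqP ->.
have [le_xy|/ltW le_yx] := leP (f x) (f y).
  exists x; rewrite ?mem_head // => z; rewrite inE => /predU1P[->//|/min_y].
  exact: le_trans.
by exists y; rewrite ?inE ?ys ?orbT // => z /predU1P[->|/min_y].
Qed.

Lemma seq_multiplier (T : eqType) (s : seq T) (f g : T -> R) :
  exists2 K : R, 0 <= K & forall x, x \in s -> 0 < g x -> f x <= K * g x.
Proof.
elim: s => [|x s [K K_ge0 KP]]; first by exists 0.
exists (K + `|f x| / `|g x|); first by rewrite addr_ge0 ?divr_ge0.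
move=> y; rewrite inE => /predU1P[->|ys] g_gt0; rewrite mulrDl.
  rewrite (gtr0_norm g_gt0) mulfVK ?gt_eqF // (le_trans (ler_norm _)) //.
  by rewrite lerDr mulr_ge0 // ltW.
apply: le_trans (KP _ ys g_gt0) _.
by rewrite lerDl mulr_ge0 ?divr_ge0 // ltW.
Qed.

(* Among the vertices on the edge, the minimiser of a functional increasing along the
   edge is an endpoint; adding a large multiple of [g] makes it supporting. *)
Lemma edge_endpoint B g (u w : 'rV[R]_d) : polytope B -> affine_fun g ->
  (forall x, B x -> 0 <= g x) -> B u -> B w -> g u = 0 -> g w = 0 -> u != w ->
  exists al v0 v1, [/\ affine_fun al /\ (forall x, B x -> 0 <= al x),
    B v0 /\ g v0 = 0, B v1 /\ g v1 = 0, al v0 = 0 & 0 < al v1].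
Proof.
move=> [V /finite_seqP[s ->] ->] aff_g g_ge0 Bu Bw gu gw ne_uw.
have Bs p : p \in s -> convex_hull [set` s] p.
  move=> ps; exists 1%N, (fun=> 1), (fun=> p).
  by split=> //; rewrite big_ord1 ?scale1r.
(* From [u] to [w] this functional increases by the squared Euclidean length of [u - w]. *)
pose be (x : 'rV[R]_d) := 0 - \sum_i (u - w) 0 i * x 0 i.
have aff_be : affine_fun be by exact: affine_fun_dot.
have lt_be : be u < be w.
  rewrite /be !sub0r ltrN2 -subr_gt0 -sumrB.
  have -> : \sum_i ((u - w) 0 i * u 0 i - (u - w) 0 i * w 0 i) = \sum_i ((u - w) 0 i) ^+ 2.
    by apply: eq_bigr => i _; rewrite -mulrBr !mxE expr2.
  rewrite lt_neqAle sumr_ge0 ?andbT => [|i _]; last exact: sqr_ge0.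
  rewrite eq_sym psumr_eq0 => [|i _]; last exact: sqr_ge0.
  apply: contraNN ne_uw => /allP eq0; apply/eqP/matrixP => i j; rewrite ord1.
  have := eq0 j (mem_index_enum j); rewrite /= sqrf_eq0 !mxE subr_eq0 => /eqP.
  by [].
(* The generators on the face [g = 0]; were there none, [g] would be positive at the convex
   combination [u]. *)
pose s0 := [seq p <- s | g p == 0].
have s0_neq0 : s0 != [::].
  apply/eqP => s0_nil; have [n [a [p [/= Sp a_ge0 sum_a equ]]]] := Bu.
  have g_gt0 i : 0 < g (p i).
    rewrite lt_neqAle g_ge0 ?andbT; last exact/Bs/Sp.
    apply/eqP => g0; have : p i \in s0 by rewrite mem_filter -g0 eqxx Sp.
    by rewrite s0_nil.
  move: gu; rewrite equ aff_g // => /eqP; rewrite psumr_eq0 => [/allP eq0|i _]; last first.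
    by rewrite mulr_ge0 // ltW.
  have : \sum_i a i = 0.
    rewrite big1 // => i _; have := eq0 i (mem_index_enum i).
    by rewrite /= mulf_eq0 (gt_eqF (g_gt0 i)) orbF => /eqP.
  by rewrite sum_a => /eqP; rewrite oner_eq0.
have [v0 + min_v0] := seq_min_exists be s0_neq0.
rewrite mem_filter => /andP[/eqP gv0 sv0].
(* Where [g = 0], minimality of [v0] makes [al] non-negative; at the other generators the term
   [K * g] does. *)
have [K K_ge0 KP] := seq_multiplier s (fun x => be v0 - be x) g.
pose al (x : 'rV[R]_d) := be x - be v0 + K * g x.
have aff_al : affine_fun al by exact: affine_funD.
have al_ge0 x : convex_hull [set` s] x -> 0 <= al x.
  apply: affine_fun_hull_ge0 => // p /= ps; rewrite /al.
  have [g0|ne_g0] := eqVneq (g p) 0.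
    by rewrite g0 mulr0 addr0 subr_ge0 min_v0 // mem_filter g0 eqxx.
  have := KP p ps; rewrite lt_neqAle eq_sym ne_g0 g_ge0 => [/(_ isT)|]; last exact: Bs.
  lra.
exists al, v0, w; split=> //; first by split=> //; exact: Bs.
  by rewrite /al gv0 subrr mulr0 addr0.
have := al_ge0 u Bu; rewrite /al gu gw mulr0 !addr0; lra.
Qed.

(** Each face of the flag is the zero set in [B] of a supporting functional, and the next face has a
    point outside it because the dimensions differ. At the bottom, [edge_endpoint] supplies the
    vertex. *)
Lemma exists_flag_coordinates B : (0 < d)%N -> polytope B -> interior B !=set0 ->
  generic B -> exists v0 e N, flag_coordinates B v0 e N.
Proof.
move=> d_gt0 polyB intB [F [faceF subF _ _]].
pose G j := if (j < d)%N then F j else B.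
have dimG j : (1 <= j <= d)%N -> has_dim (G j) j.
  rewrite /G; case: ifPn => [lt_jd /andP[j_gt0 _]|nlt le_j].
    by case: (faceF j) => //; rewrite j_gt0 -ltnS prednK.
  have -> : j = d by lia.
  exact: has_dim_interior.
have faceG j : exists g, (1 <= j <= d)%N -> [/\ affine_fun g,
    forall x, B x -> 0 <= g x & forall x, G j x <-> B x /\ g x = 0].
  have [le_j|nle] := boolP (1 <= j <= d)%N; last by exists (fun=> 0).
  have [a [c [leB eqG]]] : face B (G j).
    rewrite /G; case: ifPn => [lt_jd|_].
      by case: (faceF j) => //; case/andP: le_j => j_gt0 _; rewrite j_gt0 -ltnS prednK.
    exists 0, 0; split=> [x _|]; first by rewrite big1 // => i _; rewrite mxE mul0r.
    rewrite seteqP; split=> x /=; last by case.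
    by split=> //; rewrite big1 // => i _; rewrite mxE mul0r.
  exists (fun x => c - \sum_i a 0 i * x 0 i) => _; split.
  - exact: affine_fun_dot.
  - by move=> x /leB; rewrite subr_ge0.
  - by move=> x; rewrite eqG /=; split=> -[Bx] => [->|/eqP]; rewrite ?subrr // subr_eq0 => /eqP ->.
have {faceG} [g gP] := choice faceG.
have subG i j : (1 <= i <= j)%N -> (j <= d)%N -> G i `<=` G j.
  move=> /andP[i_gt0]; elim: j => [|j IHj]; first by lia.
  rewrite leq_eqVlt => /predU1P[->|]; first by move=> _ x.
  rewrite ltnS => le_ij lt_jd.
  apply: (subset_trans (IHj le_ij (ltnW lt_jd))).
  rewrite {1}/G lt_jd /G; case: ifPn => [lt_jd'|_]; last first.
    have [|_ _ GE] := gP j; first by lia.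
    by move=> x Fx; have [|//] := (GE x).1; rewrite /G lt_jd.
  by apply: subF; lia.
have [u [w [Gu Gw ne_uw]]] := has_dim1_two_points (dimG 1%N d_gt0).
have [aff_g1 g1_ge0 G1E] := gP 1%N d_gt0.
have [[Bu gu] [Bw gw]] := ((G1E u).1 Gu, (G1E w).1 Gw).
have [al0 [v0 [v1 [[aff_al0 al0_ge0] G1v0 G1v1 al0v0 al0v1]]]] :=
  edge_endpoint polyB aff_g1 g1_ge0 Bu Bw gu gw ne_uw.
have vP j : exists v, (1 <= j < d)%N -> G j.+1 v /\ ~ G j v.
  have [/andP[j_gt0 lt_jd]|nle] := boolP (1 <= j < d)%N; last by exists 0.
  apply: contrapT => no_v; suff /(has_dim_inj (dimG j.+1 lt_jd)) : has_dim (G j.+1) j by lia.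
  suff -> : G j.+1 = G j by apply: dimG; rewrite j_gt0 ltnW.
  rewrite seteqP; split; last by apply: subG; rewrite ?j_gt0 ?leqnSn.
  by move=> x Gx; apply: contrapT => nGx; apply: no_v; exists x.
have {vP} [v vP] := choice vP.
(* [vv 0] and [vv 1] lie on the edge; for [i >= 2], [vv i] lies in [G i] but not in [G i.-1]. *)
pose vv i := if i is i'.+1 then if i' is 0 then v1 else v i' else v0.
pose al j := if j is 0 then al0 else g j.
exists (vv 0%N), (fun i => vv i.+1 - vv 0%N), (fun j i => al j (vv i.+1)).
have Gvv i j : (maxn i 1 <= j <= d)%N -> G j (vv i).
  case: i => [|[|i]] /=; rewrite ?max0n.
  - by move=> /andP[h1 h2]; apply: (subG 1%N j) => //; apply/G1E.
  - by move=> /andP[h1 h2]; apply: (subG 1%N j) => //; apply/G1E.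
  - move=> h; have [|Gv _] := vP i.+1; first by lia.
    by apply: (subG i.+2 j) => //; lia.
apply: flag_coordinatesP => //.
- by case=> [//|j] lt_jd; have [] := gP j.+1 (ltnW lt_jd).
- move=> i le_id; have [|_ _ GE] := gP d; first by rewrite d_gt0 leqnn.
  by have [|//] := (GE (vv i)).1; apply: Gvv; rewrite leqnn andbT geq_max le_id.
- move=> i [|j] /andP[le_ij lt_jd]; first by move: le_ij; rewrite leqn0 => /eqP ->.
  have [|_ _ GE] := gP j.+1; first exact: ltnW.
  by have [|//] := (GE (vv i)).1; apply: Gvv; rewrite (ltnW lt_jd) andbT geq_max le_ij.
- case=> [//|j] lt_jd; have [|_ g_ge0 GE] := gP j.+1; first exact: ltnW.
  have [|Gv nGv] := vP j.+1; first exact: lt_jd.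
  have [|_ _ GE'] := gP j.+2; first exact: lt_jd.
  have [Bv _] := (GE' _).1 Gv.
  rewrite lt_neqAle g_ge0 // andbT; apply/eqP => g0; apply: nGv.
  by apply/GE.
Qed.
End Geometry.

(** * Orthants in a grid as homothets *)

Section Grid.
Variables (R : realType) (d : nat).
Implicit Types (B : set 'rV[R]_d).

Lemma scale_exists (N : 'I_d -> 'I_d -> R) (M : nat) : (forall j, 0 < N j j) ->
  exists2 eps : R, 0 < eps <= 1 &
    forall j, eps * ((2 * M)%N%:R * \sum_i `|N j i|) < N j j.
Proof.
move=> N_gt0; pose K j := (2 * M)%N%:R * (\sum_i `|N j i|) / N j j.
have K_ge0 j : 0 <= K j by rewrite divr_ge0 ?mulr_ge0 ?sumr_ge0 // ltW.
have S_gt0 : 0 < 1 + \sum_j K j by rewrite ltr_wpDr ?sumr_ge0.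
exists (1 + \sum_j K j)^-1.
  by rewrite invr_gt0 S_gt0 invf_le1 // lerDl sumr_ge0.
move=> j; have ltK : K j < 1 + \sum_i K i.
  by rewrite (bigD1 j) //= addrCA ltrDl ltr_wpDr ?sumr_ge0.
by rewrite mulrC ltr_pdivrMr // [X in _ < X]mulrC -ltr_pdivrMr.
Qed.

(** A homothet with its vertex just below the grid point of [w] contains the points dominating [w]
    by the simplex condition. If [y j < w j], row [j] of [N] excludes [y]: earlier coordinates do
    not enter it, and later ones are smaller by a factor [eps]. *)
Lemma corner_grid B v0 e N (M : nat) : flag_coordinates B v0 e N ->
  exists (p : {ffun 'I_d -> 'I_M} -> 'rV[R]_d) (C : {ffun 'I_d -> 'I_M} -> set 'rV[R]_d),
    (forall w, homothets B (C w)) /\ (forall w y, C w (p y) <-> dominance w y).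
Proof.
move=> [coneB N0 N_gt0 B_N].
have [eps /andP[eps_gt0 eps_le1] epsN] := scale_exists M N_gt0.
pose pt (z : 'I_d -> R) := \sum_(i < d) (eps ^+ i * z i) *: e i.
(* Doubling and shifting by one makes this an odd integer: at least 1 if [w i <= y i], at most -1
   otherwise. *)
pose x (w y : {ffun 'I_d -> 'I_M}) (i : 'I_d) : R := (y i)%:R *+ 2 - ((w i)%:R *+ 2 - 1).
(* The [d] coordinates are at most [2 M] each, so after division by [t] they fit in the simplex. *)
pose t : R := 1 + (d * (2 * M))%N%:R.
have t_gt0 : 0 < t by rewrite ltr_wpDr.
pose p (y : {ffun 'I_d -> 'I_M}) := pt (fun i => (y i)%:R *+ 2).
pose z (w : {ffun 'I_d -> 'I_M}) := pt (fun i => (w i)%:R *+ 2 - 1).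
exists p, (fun w => [set t *: b + (z w - t *: v0) | b in B]).
split=> [w|w y]; first by exists t, (z w - t *: v0).
have pB b : p y = t *: b + (z w - t *: v0) <->
    b = v0 + \sum_(i < d) (t^-1 * (eps ^+ i * x w y i)) *: e i.
  have -> : \sum_(i < d) (t^-1 * (eps ^+ i * x w y i)) *: e i = t^-1 *: (p y - z w).
    rewrite /p /z /pt -sumrB scaler_sumr; apply: eq_bigr => i _.
    by rewrite -scalerBl -mulrBr scalerA.
  split=> [->|->].
    by rewrite addrA addrAC addrK -scalerBr scalerA mulVf ?gt_eqF // scale1r addrC subrK.
  rewrite scalerDr scalerA mulfV ?gt_eqF // scale1r.
  by rewrite [RHS]addrC addrA subrK [RHS]addrC subrK.
have xE i : x w y i = (if (w i <= y i)%N then 1 + (2 * (y i - w i))%N%:R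
    else - (2 * (w i - y i)).-1%:R).
  rewrite /x; case: ifPn => [le_wy|].
    by rewrite natrM natrB //; ring.
  rewrite -ltnNge => lt_yw; rewrite -subn1 natrB ?natrM ?natrB ?(ltnW lt_yw) //; last by lia.
  by ring.
have x_bound i : `|x w y i| <= (2 * M)%N%:R.
  have := ltn_ord (y i); have := ltn_ord (w i) => lt_w lt_y; rewrite xE; case: ifP => h.
    by rewrite ger0_norm ?addr_ge0 // nat1r ler_nat; lia.
  by rewrite normrN ger0_norm // ler_nat; lia.
have eps_ge0 (i : nat) : 0 <= eps ^+ i by rewrite exprn_ge0 // ltW.
split=> [[b Bb /esym/pB eqb]|dom].
  apply/forallP => j; rewrite leqNgt; apply/negP => lt_yw.
  move: Bb; rewrite eqb => /B_N/(_ j).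
  rewrite leNgt => /negP; apply.
  have -> : \sum_(i < d) N j i * (t^-1 * (eps ^+ i * x w y i)) =
      t^-1 * \sum_(i < d) N j i * (eps ^+ i * x w y i).
    by rewrite mulr_sumr; apply: eq_bigr => i _; rewrite mulrCA.
  rewrite pmulr_rlt0 ?invr_gt0 //.
  have xj : x w y j <= -1.
    by rewrite xE leqNgt lt_yw /= lerN2 -[1]/(1%:R) ler_nat; lia.
  rewrite (bigD1 j) //=.
  have le1 : N j j * (eps ^+ j * x w y j) <= - (eps ^+ j * N j j).
    rewrite -mulrN1 [N j j * _]mulrCA -mulrA.
    by rewrite ler_wpM2l // ler_wpM2l // ltW.
  have le2 : \sum_(i < d | i != j) N j i * (eps ^+ i * x w y i) <=
      eps ^+ j * (eps * ((2 * M)%N%:R * \sum_i `|N j i|)).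
    rewrite [X in _ <= _ * (_ * (_ * X))](bigD1 j) //= !mulrDr -[X in X <= _]add0r lerD //.
      by rewrite !mulr_ge0 // ltW.
    rewrite !mulr_sumr; apply: ler_sum => i ne_ij.
    have [lt_ij|le_ji] := ltnP i j.
      by rewrite N0 // mul0r normr0 !mulr0.
    have lt_ji : (j < i)%N by rewrite ltn_neqAle eq_sym ne_ij.
    apply: le_trans (ler_norm _) _; rewrite !normrM (ger0_norm (eps_ge0 i)).
    rewrite mulrCA [X in _ <= X]mulrA -exprSr [X in _ <= _ * X]mulrC.
    apply: ler_pM; rewrite ?mulr_ge0 //.
      by rewrite ler_wiXn2l // ltW.
    by rewrite ler_wpM2l.
  apply: le_lt_trans (lerD le1 le2) _.
  by rewrite -mulrN -mulrDr pmulr_rlt0 ?exprn_gt0 // addrC subr_lt0.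
exists (v0 + \sum_(i < d) (t^-1 * (eps ^+ i * x w y i)) *: e i); last by apply/esym/pB.
have x_ge0 i : 0 <= x w y i by rewrite xE (forallP dom) addr_ge0.
apply: coneB => [i|]; first by rewrite !mulr_ge0 // invr_ge0 ltW.
rewrite -mulr_sumr mulrC ler_pdivrMr // mul1r /t.
apply: (@le_trans _ _ (\sum_(i < d) (2 * M)%N%:R)).
  apply: ler_sum => i _; rewrite -[X in _ <= X]mul1r ler_pM //.
    by rewrite exprn_ile1 // ltW.
  by rewrite (le_trans (ler_norm _)).
by rewrite sumr_const card_ord -mulrnA [(2 * M * d)%N]mulnC lerDr.
Qed.

Lemma dominance_anti M (w y : {ffun 'I_d -> 'I_M}) : dominance w y -> dominance y w -> w = y.
Proof.
move=> /forallP h1 /forallP h2; apply/ffunP => i; apply: val_inj.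
by apply/eqP; rewrite eqn_leq h1 h2.
Qed.

Lemma dominance_refl M (w : {ffun 'I_d -> 'I_M}) : dominance w w.
Proof. by apply/forallP. Qed.

Lemma card_fset_seq (T : choiceType) (L : seq T) : uniq L -> #|` [fset x in L]%fset| = size L.
Proof. by move=> uL; rewrite card_fseq undup_id. Qed.

Lemma trace_coloring B (P : {fset 'rV[R]_d}) (D : nat) :
  (disc (trace_family (homothets B) P) <= D)%N ->
  exists chi : 'rV[R]_d -> bool, forall F, homothets B F ->
    (`|(\sum_(x <- P | `[< F x >]) (-1) ^+ chi x : int)%R| <= D)%N.
Proof.
rewrite /disc; case: arg_minnP => // col _ _ leD.
(* The default colour is never read by a sum over [P]. *)
pose chi (x : 'rV[R]_d) : bool := if (insub x : option P) is Some y then col y else false.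
exists chi => F BF.
pose A : {set P} := [set q : P | `[< F (val q) >]]%SET.
have A_in : A \in trace_family (homothets B) P.
  rewrite inE; apply/asboolP; exists F => // q; rewrite inE.
  by split=> /asboolP.
apply: leq_trans leD; rewrite /coloring_disc.
have -> : \sum_(x <- P | `[< F x >]) (-1) ^+ chi x = \sum_(q in A) (-1) ^+ col q :> int.
  rewrite big_seq_fsetE /=.
  by apply: eq_big => [q|q _]; rewrite ?inE // /chi valK.
by rewrite (bigD1 A) //= leq_maxl.
Qed.
End Grid.

(** * Padding to exactly [n] points and the final estimate *)

Lemma hereditary_of_disc (R : realType) (d : nat) (B : set 'rV[R]_d.+1) v0 e N
    (m n D k : nat) (f g : 'I_k -> {ffun 'I_d.+1 -> 'I_m}) :
  flag_coordinates B v0 e N -> (m ^ d.+1 <= n)%N ->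
  (forall P : {fset 'rV[R]_d.+1}, #|` P| = n ->
     disc (trace_family (homothets B) P) <= D)%N ->
  injective g ->
  hereditary_disc_le (\matrix_(i, j) ((dominance (f i) (g j))%:R : int)) D.
Proof.
move=> flag le_mn discD g_inj J.
(* The upper [m] values of each coordinate carry the given grid; the lower [n] provide padding
   points that no homothet based at a shifted [w] contains. *)
have [p [C [hC Cp]]] := corner_grid (n + m) flag.
have p_inj : injective p.
  move=> y y' eqp; apply: dominance_anti.
    by apply/Cp; rewrite -eqp; apply/Cp/dominance_refl.
  by apply/Cp; rewrite eqp; apply/Cp/dominance_refl.
pose shift (y : {ffun 'I_d.+1 -> 'I_m}) : {ffun 'I_d.+1 -> 'I_(n + m)} :=
  [ffun i => rshift n (y i)].
have shift_inj : injective shift.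
  move=> y y' /ffunP eqs; apply/ffunP => i; have := eqs i.
  by rewrite !ffunE => /rshift_inj.
pose low (t : 'I_n) : {ffun 'I_d.+1 -> 'I_(n + m)} := [ffun=> lshift m t].
have low_inj : injective low.
  by move=> t t' /ffunP/(_ ord0); rewrite !ffunE => /lshift_inj.
have low_shift t y : low t != shift y.
  by apply/eqP => /ffunP/(_ ord0); rewrite !ffunE => /eqP; rewrite eq_lrshift.
have dom_shift w y : dominance (shift w) (shift y) = dominance w y.
  by apply: eq_forallb => i; rewrite !ffunE /= leq_add2l.
have dom_low w t : dominance (shift w) (low t) = false.
  apply/negbTE; rewrite negb_forall; apply/existsP; exists ord0.
  by rewrite !ffunE /= -ltnNge ltn_addr.
have le_Jn : (#|J| <= n)%N.
  apply: leq_trans le_mn; rewrite -(card_imset _ g_inj).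
  by apply: leq_trans (max_card _) _; rewrite card_ffun !card_ord.
pose L1 := [seq p (shift (g i)) | i <- enum J].
pose L2 := [seq p (low t) | t <- take (n - #|J|) (enum 'I_n)].
have uL : uniq (L1 ++ L2).
  rewrite cat_uniq !map_inj_uniq ?enum_uniq ?take_uniq ?enum_uniq ?andbT //=; last first.
  - by move=> i j /p_inj/shift_inj/g_inj.
  - by move=> i j /p_inj/low_inj.
  apply/hasPn => _ /mapP[t _ ->]; apply/negP => /mapP[i _ /p_inj/eqP].
  by rewrite (negPf (low_shift _ _)).
have sizeL : size (L1 ++ L2) = n.
  rewrite size_cat !size_map -cardE size_take size_enum_ord.
  by case: ltnP => h; move: h le_Jn; move: #|J| => j; lia.
pose P := [fset x in L1 ++ L2]%fset.
have cardP : #|` P| = n by rewrite card_fset_seq.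
have [chi chiD] := trace_coloring (discD P cardP).
(* The padding points contribute nothing to the sums, so colouring all of [P] amounts to colouring
   [J]. *)
exists (\col_j (if j \in J then (-1) ^+ chi (p (shift (g j))) else 0)); split.
  move=> i; rewrite mxE; case: ifP => _; last by exists 0.
  by case: (chi _); [exists 1|exists 0].
have perm_PL : perm_eq P (L1 ++ L2).
  by apply: uniq_perm => // x; rewrite !inE mem_cat.
move=> i; set chi_J := \col_j _.
suff -> : ((\matrix_(i, j) ((dominance (f i) (g j))%:R : int)) *m chi_J) i 0 =
    \sum_(x <- P | `[< C (shift (f i)) x >]) (-1) ^+ chi x by exact: chiD.
rewrite (perm_big _ perm_PL) big_cat /= [X in _ + X]big1_seq ?addr0; last first.
  by move=> x /andP[/asboolP + /mapP[t _ eqx]]; rewrite eqx => /Cp; rewrite dom_low.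
rewrite big_map big_enum_cond big_mkcond mxE /=; apply: eq_bigr => j _.
have -> : `[< C (shift (f i)) (p (shift (g j))) >] = dominance (f i) (g j).
  by rewrite -dom_shift; apply/asboolP/idP => /Cp.
rewrite !mxE; case: (j \in J) => /=; last by rewrite mulr0.
by case: dominance; rewrite ?mul1r ?mul0r.
Qed.

Lemma exists_large_disc (R : realType) (d : nat) (B : set 'rV[R]_d.+1) v0 e N (u n : nat) :
  flag_coordinates B v0 e N -> ((4 * 2 ^ (d.+1 * u)) ^ d.+1 <= n)%N ->
  exists2 P : {fset 'rV[R]_d.+1}, #|` P| = n &
    (u.+1 ^ d <= 8 ^ d.+2 * disc (trace_family (homothets B) P))%N.
Proof.
move=> flag le_n; apply: contrapT => noP.
(* The largest [D] with [8 ^ d.+2 * D < u.+1 ^ d], hence an upper bound for all discrepancies if the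
   claim fails. *)
pose D := ((u.+1 ^ d).-1 %/ 8 ^ d.+2)%N.
have E_gt0 : (0 < u.+1 ^ d)%N by rewrite expn_gt0.
have : (u.+1 ^ d <= 8 ^ d.+2 * D)%N.
  apply: hereditary_grid_lower_bound => k f g g_inj.
  apply: (hereditary_of_disc f flag le_n _ g_inj) => P cardP.
  rewrite leq_divRL ?expn_gt0 // -ltnS prednK // mulnC ltnNge.
  by apply/negP => le_E; apply: noP; exists P.
rewrite mulnC /D => le_E; have := leq_trunc_div (u.+1 ^ d).-1 (8 ^ d.+2); lia.
Qed.

Lemma ln_le_trunc_log (R : realType) (n : nat) : (0 < n)%N ->
  ln (n%:R : R) <= (trunc_log 2 n).+1%:R.
Proof.
move=> n_gt0; rewrite -[X in _ <= X]expRK ler_ln ?posrE ?ltr0n ?expR_gt0 //.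
apply: (@le_trans _ _ (2 ^ (trunc_log 2 n).+1)%N%:R).
  by rewrite ler_nat ltnW // trunc_log_ltn.
(* The comparison of bases 2 and e comes down to [1 + 1 <= expR 1]. *)
rewrite -[X in expR X]mulr1 expRM_natl natrX lerXn2r ?nnegrE ?expR_ge0 ?ler0n //.
by have := expR_ge1Dx (1 : R); lra.
Qed.


Theorem theorem3 (R : realType) (d : nat) (d_gt0 : (0 < d)%N)
    (B : set 'rV[R]_d) (Bpoly : polytope B) (Bint : interior B !=set0)
    (Bgen : generic B) :
  exists2 c : R, 0 < c &
  exists n0 : nat, forall n : nat, (n0 <= n)%N ->
    ((c * ln (n%:R : R) ^+ d.-1)%:E <= disc_n n (homothets B))%E.
Proof.
case: d => [//|d] in d_gt0 B Bpoly Bint Bgen *.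
have [v0 [e [N flag]]] := exists_flag_coordinates d_gt0 Bpoly Bint Bgen.
(* With [t] and [u] as below, [t + 1 <= (u + 3) * d.+1 ^ 2 <= K * u.+1]. *)
pose K := (3 * d.+1 ^ 2)%N.
have c_gt0 : (0 < K ^ d * 8 ^ d.+2)%N.
  by rewrite muln_gt0 expn_gt0 /K muln_gt0 expn_gt0 /= expn_gt0.
exists (K ^ d * 8 ^ d.+2)%N%:R^-1; first by rewrite invr_gt0 ltr0n.
exists (2 ^ (2 * d.+1 ^ 2))%N => n le_n.
have n_gt0 : (0 < n)%N by apply: leq_trans le_n; rewrite expn_gt0.
(* The grid has [2 ^ (2 * d.+1 + d.+1 ^ 2 * u)] points. Subtracting 2 absorbs the first summand, so
   this is at most [2 ^ t]; the choice of [n0] makes the subtraction exact. *)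
pose t := trunc_log 2 n; pose u := (t %/ d.+1 ^ 2 - 2)%N.
have le_t : (2 * d.+1 ^ 2 <= t)%N by apply: trunc_log_max.
have d2_gt0 : (0 < d.+1 ^ 2)%N by rewrite expn_gt0.
have uE : (t %/ d.+1 ^ 2 = u + 2)%N.
  by rewrite subnK // leq_divRL.
have [P cardP leP] : exists2 P : {fset 'rV[R]_d.+1}, #|` P| = n &
    (u.+1 ^ d <= 8 ^ d.+2 * disc (trace_family (homothets B) P))%N.
  apply: exists_large_disc flag _.
  apply: (@leq_trans (2 ^ t)); last by have /andP[] := trunc_log_bounds (isT : 1 < 2)%N n_gt0.
  rewrite -[4%N]/(2 ^ 2)%N -expnD -expnM leq_exp2l //.
  apply: leq_trans (leq_trunc_div t (d.+1 ^ 2)); rewrite uE -mulnn; nia.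
apply: le_trans (ereal_sup_ubound _); last by exists P.
rewrite lee_fin mulrC ler_pdivrMr ?ltr0n //.
have le_ln : ln (n%:R : R) <= (K * u.+1)%N%:R.
  apply: le_trans (ln_le_trunc_log R n_gt0) _; rewrite ler_nat -/t.
  have := ltn_ceil t d2_gt0; rewrite uE /K; nia.
apply: (@le_trans _ _ ((K * u.+1) ^ d)%N%:R).
  by rewrite natrX lerXn2r ?nnegrE ?ler0n // ln_ge0 // ler1n.
by rewrite -natrM ler_nat expnMn [X in (_ <= X)%N]mulnCA leq_mul2l [X in (_ <= X)%N]mulnC leP orbT.
Qed.
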